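(* Let $A\in(0,1)$ and let $\alpha>0$ be such that the arithmetic graph $\widehat\Gamma_\alpha(A)$ is well defined. Then, disregarding isolated vertices, $\widehat\Gamma_\alpha(A)$ is a disjoint union of embedded polygons and bi-infinite embedded polygonal curves.
   Context: Outer billiards: for $A\in(0,1)$ let $K(A)$ be the kite with vertices $(-1,0),(0,1),(0,-1),(A,0)$. For $x\in\mathbb{R}^2\setminus K(A)$, the outer billiards map sends $x$ to the point $\psi'(x)$ such that the segment $\overline{x\psi'(x)}$ is tangent to $K(A)$ at its midpoint and $K(A)$ lies to the right of the ray from $x$ to $\psi'(x)$ (undefined when the tangent ray contains an edge). Let $\psi=(\psi')^2$, let $\Xi=\mathbb{R}_+\times\{-1,1\}$, and let $\Psi:\Xi\to\Xi$ be the first return map of $\psi$ to $\Xi$ (it is defined at every point of $\Xi$ having a well-defined outer billiards orbit). Define $M_{A,\alpha}:\mathbb{Z}^2\to\mathbb{R}\times\{-1,1\}$ by $$M_{A,\alpha}(m,n)=\big(2Am+2n+2\alpha,\ (-1)^{m+n+1}\big).$$ For $p_1,p_2\in\mathbb{Z}^2$ write $p_1\to p_2$ iff $\zeta_j=M_{A,\alpha}(p_j)\in\Xi$ for $j=1,2$, $\Psi(\zeta_1)=\zeta_2$, and $\|p_1-p_2\|\le\sqrt2$. The arithmetic graph $\widehat\Gamma_\alpha(A)$ is the resulting graph with vertices in $\mathbb{Z}^2$, drawn in the plane with straight line segments as edges. It is well defined if every point of $M_{A,\alpha}(\mathbb{Z}^2)\cap\Xi$ has a completely defined outer billiards orbit.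 Vertices with $\Psi(\zeta)=\zeta$ give isolated points (trivial components), which are ignored. *)

(* Defs.v *)
From mathcomp Require Import all_boot all_order all_algebra.
From mathcomp Require Import all_classical all_reals.

Set Implicit Arguments.
Unset Strict Implicit.
Unset Printing Implicit Defensive.

Import Order.TTheory GRing.Theory Num.Theory.

Local Open Scope classical_set_scope.
Local Open Scope ring_scope.

Section PlaneGeometry.
Variable R : realType.
Implicit Types (x y z : R * R) (p q : int * int).

Definition lerp x y (t : R) : R * R :=
  ((1 - t) * x.1 + t * y.1, (1 - t) * x.2 + t * y.2).

Definition segment x y : set (R * R) :=
  [set z | exists2 t : R, 0 <= t <= 1 & z = lerp x y t].

Definition ray x y : set (R * R) :=
  [set z | exists2 t : R, 0 <= t & z = lerp x y t].

(* The cross product of y - x and z - x is nonpositive: z lies on the line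
   through x and y, or to the right of it when travelling from x to y. *)
Definition right_of x y z : Prop :=
  (y.1 - x.1) * (z.2 - x.2) - (y.2 - x.2) * (z.1 - x.1) <= 0.

Definition lattice_point p : R * R := (p.1%:~R, p.2%:~R).

Definition enorm x : R := Num.sqrt (x.1 ^+ 2 + x.2 ^+ 2).

(* The piecewise linear curve R -> R^2 that is at v k at the integer time k. *)
Definition polyline (v : int -> int * int) (t : R) : R * R :=
  let k := Num.floor t in
  lerp (lattice_point (v k)) (lattice_point (v (k + 1))) (t - k%:~R).

(* A closed polygon with k sides is given by its k-periodic vertex sequence;
   it is embedded when polyline v is injective modulo the period. *)
Definition embedded_polygon (v : int -> int * int) : Prop :=
  exists2 k : nat, (2 < k)%N &
    (forall i : int, v (i + k%:Z) = v i) /\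
    (forall s t : R, polyline v s = polyline v t ->
       exists j : int, s - t = (j * k%:Z)%:~R).

(* Injectivity suffices for an embedding of the line: the vertices are distinct
   lattice points, so that the curve is automatically proper. *)
Definition embedded_biinfinite_curve (v : int -> int * int) : Prop :=
  injective (polyline v).

(* edge is the (symmetric, irreflexive) adjacency relation of a graph on Z^2
   drawn with straight segments; isolated vertices play no role here. *)
Definition disjoint_union_of_embedded_curves
    (edge : int * int -> int * int -> Prop) : Prop :=
  exists C : set (int -> int * int),
    [/\ forall v, C v -> embedded_polygon v \/ embedded_biinfinite_curve v,
        trivIset C (fun v => range (polyline v)) &
        forall p q, edge p q <->
          exists2 v, C v & exists k : int,
            (p = v k /\ q = v (k + 1)) \/ (q = v k /\ p = v (k + 1))].

End PlaneGeometry.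

Section OuterBilliards.
Variables (R : realType) (A : R).
Implicit Types (x y z : R * R).

(* The vertices in cyclic order, so that the edges join vertex i to vertex
   i + 1 modulo 4. *)
Definition kite_vertex (i : 'I_4) : R * R :=
  nth (0, 0) [:: (-1, 0); (0, 1); (A, 0); (0, -1)] i.

Definition kite : set (R * R) :=
  [set z | exists w : 'I_4 -> R,
     [/\ forall i, 0 <= w i, \sum_i w i = 1 &
         z = (\sum_i w i * (kite_vertex i).1, \sum_i w i * (kite_vertex i).2)]].

Definition kite_edge (i : 'I_4) : set (R * R) :=
  segment (kite_vertex i) (kite_vertex (ordS i)).

(* The graph of the partial map psi': y = psi'(x). *)
Definition outer_billiards x y : Prop :=
  [/\ ~ kite x,
      kite (lerp x y 2^-1),
      forall z, kite z -> right_of x y z &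
      ~ exists i, kite_edge i `<=` ray x y].

(* The graph of psi = (psi')^2. *)
Definition outer_billiards2 x z : Prop :=
  exists2 y, outer_billiards x y & outer_billiards y z.

(* All forward and backward iterates of psi' are defined at x. *)
Definition completely_defined_orbit x : Prop :=
  exists u : int -> R * R,
    u 0 = x /\ forall k : int, outer_billiards (u k) (u (k + 1)).

Definition Xi : set (R * R) :=
  [set z | 0 < z.1 /\ (z.2 = 1 \/ z.2 = -1)].

(* The graph of the first return map Psi of psi to Xi. *)
Definition first_return x y : Prop :=
  exists (n : nat) (u : nat -> R * R),
    [/\ (0 < n)%N,
        u 0%N = x /\ u n = y,
        forall k, (k < n)%N -> outer_billiards2 (u k) (u k.+1),
        Xi x /\ Xi y &
        forall k, (0 < k < n)%N -> ~ Xi (u k)].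

Variable alpha : R.
Implicit Types p q : int * int.

Definition M_map p : R * R :=
  (2 * A * p.1%:~R + 2 * p.2%:~R + 2 * alpha, (-1) ^ (p.1 + p.2 + 1)).

Definition arith_arrow p q : Prop :=
  [/\ Xi (M_map p), Xi (M_map q), first_return (M_map p) (M_map q) &
      enorm (lattice_point R (p - q)) <= Num.sqrt 2].

Definition arith_graph_edge p q : Prop :=
  p <> q /\ (arith_arrow p q \/ arith_arrow q p).

Definition arith_graph_well_defined : Prop :=
  forall p, Xi (M_map p) -> completely_defined_orbit (M_map p).

End OuterBilliards.

(* Main.v *)
Require Import Defs.
From mathcomp Require Import all_boot all_order all_algebra.
From mathcomp Require Import all_classical all_reals.
From mathcomp Require Import ring lra zify.

(** Starting at (x, h) in Xi, the square psi of the outer billiards map carries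
a point through the upper half plane by a translations by (0, 4), then b
translations by (-2, 2), c by (-2 - 2A, 0), d by (-2, -2) and e by (0, -4); the
direction changes when the point enters one of four strips parallel to the
sides of the kite.  The only exception, close to the kite, is a single
translation by (-2A, -2), which has the same effect as d = -1.  The reflection
in the x-axis conjugates psi with its inverse, so the orbit in the lower half
plane is the mirror image of another such path run backwards.  Hence the
displacement of the first return map is determined by linear inequalities in A
and the positions u, w, s, r within the four strips.  These inequalities show
that the displacement is a king's move, that the return map does not backtrack
along an edge, and that two diagonal edges never cross; edges joining
neighbouring lattice points cannot meet in any other way. *)

Set Implicit Arguments.
Unset Strict Implicit.
Unset Printing Implicit Defensive.

Import Order.TTheory GRing.Theory Num.Theory.
Local Open Scope ring_scope.

(** Each strip lies between the line through a side of the kite and the image of that line under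
    reflection in the vertex farthest from the side. Measured by its linear form, its width is the
    change of that form under the translation leading into it: 4 for [u] and [r], [2 + 2 * A] for
    [w] and [s]. So each count is the one integer that brings the form into its interval; the
    boundary is excluded because psi or its inverse is undefined there. Subtracting the strip
    equations of a path and of its mirror path leaves a triangular system for the increments, and
    the widths allow 16 solutions. The obstacle is that this list is closed under negation: from the
    state on arrival, the negated move satisfies all inequalities, so they alone do not forbid going
    back. But the state on arrival belongs to the height opposite to that of the arrival point, and
    the next departure starts from a state shifted by 2 modulo 4. This shift excludes
    backtracking. *)

Section Integers.
Variable R : realType.

(** Counts the translations until a strip is reached. The closed end 0 is excluded later, by the
    dead-end lemmas. *)
Lemma nat_ceil (z L : R) : 0 < L -> - L < z ->
  exists n : nat, - L < z - L * n%:R <= 0.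
Proof.
move=> L0 zL; have := floor_itv (- z / L).
set m := Num.floor _ => /andP[m1 m2].
have m0 : m <= 0.
  rewrite -ltzD1 -(ltr_int R); apply: le_lt_trans m1 _.
  by rewrite add0r ltr_pdivrMr // mul1r; lra.
exists `|m|%N; rewrite natr_absz ler0_norm // rmorphN /=.
move: m1 m2; rewrite ler_pdivlMr // ltr_pdivrMr // rmorphD /= => m1 m2.
by rewrite mulrN opprK mulrC; lra.
Qed.

Lemma odd_level (j : int) : - 1 <= 2 * j%:~R - 1 :> R ->
  exists e : nat, 2 * j%:~R - 1 - 4 * e%:R = 1 :> R \/
                  2 * j%:~R - 1 - 4 * e%:R = - 1 :> R.
Proof.
move=> j1; have : (0 : R) <= j%:~R by lra.
rewrite ler0z; case: j j1 => // j _ _; exists j./2.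
have -> : (Posz j)%:~R = (odd j)%:R + 2 * (j./2)%:R :> R.
  by rewrite -pmulrn -{1}(odd_double_half j) -mul2n natrD natrM.
by case: (odd j); [left|right]; rewrite /=; lra.
Qed.

Lemma small_int (z : int) (K : R) : 0 < K -> - 2 * K < K * z%:~R ->
  K * z%:~R < 2 * K -> [\/ z = -1, z = 0 | z = 1].
Proof.
move=> K0 z1 z2.
have {z1} : (-2)%:~R < z%:~R :> R by rewrite -(ltr_pM2l K0) rmorphN /=; lra.
have {z2} : z%:~R < 2%:~R :> R by rewrite -(ltr_pM2l K0) /=; lra.
rewrite !ltr_int => z1 z2.
have [->|[->|->]] : z = -1 \/ z = 0 \/ z = 1 by lia.
- by constructor 1.
- by constructor 2.
by constructor 3.
Qed.

End Integers.

(** * Outer billiards as reflection in a vertex *)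

Section Tangency.
Variables (R : realType) (A : R).
Hypothesis hA : 0 < A < 1.
Implicit Types (x y : R) (P Q S : R * R).

(* The vertex of tangency is the end of the last edge, in clockwise order, that
   has the point on its outer side. *)
Definition tangent P Q : Prop :=
  let: (x, y) := P in
  [\/ [/\ - x - y > 1, - x + y < 1 & Q = (- 2 - x, - y)],
      [/\ - x + y > 1, x + A * y < A & Q = (- x, 2 - y)],
      [/\ x + A * y > A, x - A * y < A & Q = (2 * A - x, - y)] |
      [/\ x - A * y > A, - x - y < 1 & Q = (- x, - 2 - y)]].

Lemma kiteP x y : kite A (x, y) <->
  [/\ - x + y <= 1, x + A * y <= A, x - A * y <= A & - x - y <= 1].
Proof.
have /andP[A0 A1] := hA.
have kite_of w : (forall i, 0 <= w i) -> \sum_i w i = 1 ->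
  (x, y) = (\sum_i w i * (kite_vertex A i).1,
            \sum_i w i * (kite_vertex A i).2) -> kite A (x, y).
  by move=> w0 w1 e; exists w; split.
split.
  move=> [w [w0 w1 [-> ->]]].
  have := w0 ord0; have := w0 (lift ord0 ord0).
  have := w0 (lift ord0 (lift ord0 ord0)).
  have := w0 (lift ord0 (lift ord0 (lift ord0 ord0))).
  move: w1; rewrite !big_ord_recl !big_ord0 /= /kite_vertex /=.
  set a := w _; set b := w _; set c := w _; set d := w _.
  move=> s1 d0 c0 b0 a0.
  have Ap z : 0 <= z -> 0 <= A * z by move=> ?; apply: mulr_ge0 => //; apply: ltW.
  have := Ap _ a0; have := Ap _ b0; have := Ap _ c0; have := Ap _ d0.
  have : A * (a + b + c + d) = A by rewrite -[RHS]mulr1; congr (_ * _); lra.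
  split; lra.
move=> [h1 h2 h3 h4].
have A1p : 0 < 1 + A by lra.
have nA : 1 + A != 0 by rewrite gt_eqF.
have wgt (s t : R) : 0 <= s -> 0 <= t -> s + t = `|y| ->
    s - t = y -> `|y| <= 1 -> - 1 + `|y| <= x <= A - A * `|y| -> kite A (x, y).
  move=> s0 t0 st1 st2 y1 hx.
  pose c := (x + 1 - `|y|) / (1 + A).
  have c0 : 0 <= c by apply: divr_ge0; lra.
  have cE : c * (1 + A) = x + 1 - `|y| by rewrite /c mulfVK.
  have c1 : c <= 1 - `|y|.
    rewrite /c ler_pdivrMr; last by lra.
    nra.
  apply: (kite_of (fun i => nth 0 [:: 1 - `|y| - c; s; c; t] i)).
  - move=> i; case: i => [[|[|[|[|//]]]]] //= _; lra.
  - rewrite !big_ord_recl !big_ord0 /=; lra.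
  - rewrite !big_ord_recl !big_ord0 /= /kite_vertex /=; congr pair; lra.
have [y0|y0] := leP 0 y.
  by apply: (wgt y 0); rewrite ?ger0_norm //; nra.
by apply: (wgt 0 (- y)); rewrite ?ltr0_norm //; nra.
Qed.

Definition side P Q S : R :=
  (Q.1 - P.1) * (S.2 - P.2) - (Q.2 - P.2) * (S.1 - P.1).

Lemma kite_vertex_in i : kite A (kite_vertex A i).
Proof.
have /andP[A0 A1] := hA.
by case: i => [[|[|[|[|//]]]]] //= i; rewrite /kite_vertex /=; apply/kiteP;
  split; nra.
Qed.

Lemma side_kite P Q (w : 'I_4 -> R) : \sum_i w i = 1 ->
  side P Q (\sum_i w i * (kite_vertex A i).1, \sum_i w i * (kite_vertex A i).2)
  = \sum_i w i * side P Q (kite_vertex A i).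
Proof.
have /andP[A0 A1] := hA.
rewrite !big_ord_recl !big_ord0 /= /kite_vertex /= /side /=.
set a := w _; set b := w _; set c := w _; set d := w _ => s1.
have -> : a = 1 - b - c - d by lra.
ring.
Qed.

(** Otherwise [P] would lie between [S] and the midpoint of [P] and [Q], two points of the kite, and
    convexity would put [P] in the kite. *)
Lemma on_ray P Q S : ~ kite A P -> kite A (lerp P Q 2^-1) -> kite A S ->
  side P Q S = 0 -> ray P Q S.
Proof.
have /andP[A0 A1] := hA.
move: P Q S => [px py] [qx qy] [sx sy] nP; rewrite /lerp /= => kM kS.
rewrite /side /= => s0.
have [dx dxE] : exists dx, qx - px = dx by eexists.
have [dy dyE] : exists dy, qy - py = dy by eexists.
rewrite dxE dyE in s0.
pose n := dx ^+ 2 + dy ^+ 2.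
have n0 : 0 < n.
  rewrite lt_neqAle addr_ge0 ?sqr_ge0 // andbT eq_sym paddr_eq0 ?sqr_ge0 //.
  rewrite !sqrf_eq0; apply/negP => /andP[/eqP x0 /eqP y0]; apply: nP.
  move: kM; congr (kite A (_, _)); lra.
have [t tn] : exists t, t * n = (sx - px) * dx + (sy - py) * dy.
  by exists (((sx - px) * dx + (sy - py) * dy) / n); rewrite divfK ?gt_eqF.
have nn : n != 0 by rewrite gt_eqF.
have ex : sx - px = t * dx.
  apply: (mulIf nn); rewrite mulrAC tn /n.
  by have := congr1 ( *%R dy) s0; rewrite mulr0; lra.
have ey : sy - py = t * dy.
  apply: (mulIf nn); rewrite mulrAC tn /n.
  by have := congr1 ( *%R dx) s0; rewrite mulr0; lra.
have eqx : qx = px + dx by lra.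
have eqy : qy = py + dy by lra.
have esx : sx = px + t * dx by lra.
have esy : sy = py + t * dy by lra.
subst sx sy qx qy.
have [t0|t0] := leP 0 t.
  by exists t => //; rewrite /lerp /=; congr pair; ring.
exfalso; apply: nP; move: kM kS => /kiteP[m1 m2 m3 m4] /kiteP[k1 k2 k3 k4].
have d0 : 0 < 2^-1 - t by lra.
have nt : 0 < - t by lra.
have := ler_wpM2l (ltW nt) m1; have := ler_wpM2l (ltW nt) m2.
have := ler_wpM2l (ltW nt) m3; have := ler_wpM2l (ltW nt) m4.
by move=> ? ? ? ?; apply/kiteP; split; rewrite -(ler_pM2l d0); lra.
Qed.

(** Two vertices on the tangent line are either adjacent, and then the ray contains an edge, or
    opposite, and then the other two vertices cannot both lie to the right unless [P = Q], which
    would put [P] in the kite. *)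
Lemma edge_side P Q i j : outer_billiards A P Q -> i != j ->
  side P Q (kite_vertex A i) = 0 -> side P Q (kite_vertex A j) < 0.
Proof.
have /andP[A0 A1] := hA.
move=> [nP kM rP eP] ij si.
have sj : side P Q (kite_vertex A j) <= 0 by apply: rP; exact: kite_vertex_in _.
rewrite lt_neqAle sj andbT; apply/negP => /eqP sj0.
have rayE k : side P Q (kite_vertex A k) = 0 ->
    side P Q (kite_vertex A (ordS k)) = 0 -> False.
  move=> s1 s2; apply: eP; exists k => z [t /andP[t0 t1] ->].
  have [a a0 ->] := on_ray nP kM (kite_vertex_in _) s1.
  have [b b0 ->] := on_ray nP kM (kite_vertex_in _) s2.
  exists ((1 - t) * a + t * b); first by nra.
  by rewrite /lerp /=; congr pair; ring.
have PQ : P.1 = Q.1 -> P.2 = Q.2 -> False.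
  move=> e1 e2; apply: nP; move: kM; congr (kite A _).
  rewrite /lerp -e1 -e2 [RHS]surjective_pairing; congr pair; lra.
have sk k : side P Q (kite_vertex A k) <= 0 by apply: rP; exact: kite_vertex_in _.
have := sk (inord 0); have := sk (inord 1); have := sk (inord 2).
have := sk (inord 3).
rewrite /side /kite_vertex /= !inordK //=.
move=> h3 h2 h1 h0.
have opp02 : side P Q (kite_vertex A (inord 0)) = 0 ->
    side P Q (kite_vertex A (inord 2)) = 0 -> False.
  rewrite /side /kite_vertex /= !inordK //= => e0 e2.
  have d2 : Q.2 - P.2 = 0 by nra.
  rewrite d2 in e0 e2 h1 h3 h0 h2.
  by apply: PQ; nra.
have opp13 : side P Q (kite_vertex A (inord 1)) = 0 ->
    side P Q (kite_vertex A (inord 3)) = 0 -> False.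
  rewrite /side /kite_vertex /= !inordK //= => e0 e2.
  have d2 : Q.1 - P.1 = 0 by nra.
  rewrite d2 in e0 e2 h1 h3 h0 h2.
  by apply: PQ; nra.
have oS k : (k < 4)%N -> ordS (inord k : 'I_4) = inord (k.+1 %% 4).
  by move=> k4; apply: val_inj; rewrite /= !inordK // ltn_pmod.
move: si {sj} sj0 ij; rewrite -(inord_val i) -(inord_val j).
case: i => [[|[|[|[|//]]]]] //= _; case: j => [[|[|[|[|//]]]]] //= _ e1 e2 ij;
  rewrite ?eqxx // in ij; do ?[by apply: opp02 | by apply: opp13];
  first [by apply: (rayE _ e1); rewrite oS | by apply: (rayE _ e2); rewrite oS ].
Qed.

Lemma tangent_outer_billiards P Q : tangent P Q -> outer_billiards A P Q.
Proof.
have /andP[A0 A1] := hA.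
move: P => [x y] tPQ.
have nK : ~ kite A (x, y).
  by move=> /kiteP [h1 h2 h3 h4]; case: tPQ => -[t1 t2 _]; lra.
have rE : forall i, side (x, y) Q (kite_vertex A i) <= 0.
  move=> i; case: tPQ => -[t1 t2 ->]; rewrite /side;
  case: i => [[|[|[|[|//]]]]] //= i; rewrite /kite_vertex /=; nra.
split=> //.
- have kv := kite_vertex_in.
  by case: tPQ => -[t1 t2 ->];
    [move: (kv (inord 0)) | move: (kv (inord 1))
    |move: (kv (inord 2)) | move: (kv (inord 3))];
    rewrite /kite_vertex !inordK // /lerp /=; congr (kite _ (_, _)); lra.
- move=> z [w [w0 w1 ->]].
  rewrite /right_of -/(side (x, y) Q _) (side_kite _ _ w1).
  by apply: sumr_le0 => i _; rewrite mulr_ge0_le0.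
move=> [i iS].
have on0 S : ray (x, y) Q S -> side (x, y) Q S = 0.
  by move=> [t _ ->]; rewrite /side /lerp /=; ring.
have e1 : side (x, y) Q (kite_vertex A i) = 0.
  apply: on0; apply: iS; exists 0; first by rewrite lexx ler01.
  by rewrite /lerp subr0 !mul1r !mul0r !addr0 -surjective_pairing.
have e2 : side (x, y) Q (kite_vertex A (ordS i)) = 0.
  apply: on0; apply: iS; exists 1; first by rewrite lexx ler01.
  by rewrite /lerp subrr !mul1r !mul0r !add0r -surjective_pairing.
case: tPQ => -[t1 t2 eQ]; move: e1 e2; rewrite eQ /side;
case: i {iS} => [[|[|[|[|//]]]]] //= i; rewrite /kite_vertex /=; nra.
Qed.

(** The midpoint lies on the tangent line and is a convex combination of vertices on one side of it,
    so only vertices on the line carry weight. By [edge_side] there is just one, and the midpoint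
    equals it. *)
Lemma outer_billiards_tangent P Q : outer_billiards A P Q -> tangent P Q.
Proof.
have /andP[A0 A1] := hA.
move=> PQ; have [nP [w [w0 w1 mE]] rP eP] := PQ.
have := side_kite P Q w1; rewrite -mE.
have -> : side P Q (lerp P Q 2^-1) = 0 by rewrite /side /lerp /=; field.
have sle i : side P Q (kite_vertex A i) <= 0.
  by apply: rP; exact: kite_vertex_in _.
have ws i : w i * side P Q (kite_vertex A i) <= 0 by rewrite mulr_ge0_le0.
move/esym/eqP; rewrite -oppr_eq0 -sumrN psumr_eq0; last first.
  by move=> i _; rewrite oppr_ge0.
move=> /allP w_s.
have {}w_s i : w i = 0 \/ side P Q (kite_vertex A i) = 0.
  have /(_ (mem_index_enum _)) := w_s i.
  by rewrite oppr_eq0 mulf_eq0 => /orP[]/eqP; [left|right].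
have [i wi] : exists i, w i <> 0.
  apply: contrapT => /forallNP h; move: w1; rewrite big1 => [/eqP|i _].
    by rewrite eq_sym oner_eq0.
  exact: contrapT (h i).
have si : side P Q (kite_vertex A i) = 0 by case: (w_s i).
have sj j : i != j -> side P Q (kite_vertex A j) < 0 by move=> /edge_side; apply.
have wj j : i != j -> w j = 0.
  by move=> /sj; case: (w_s j) => // ->; rewrite ltxx.
have eQ : lerp P Q 2^-1 = kite_vertex A i.
  rewrite mE (bigD1 i) //= [X in (_, X)](bigD1 i) //=.
  rewrite [X in _ + X]big1 => [|j /negPf ji]; last by rewrite wj ?mul0r // eq_sym ji.
  rewrite [X in (_, _ + X)]big1 => [|j /negPf ji]; last by rewrite wj ?mul0r // eq_sym ji.
  have -> : w i = 1.
    rewrite -w1 (bigD1 i) //= big1 ?addr0 // => j /negPf ji.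
    by rewrite wj // eq_sym ji.
  by rewrite !mul1r !addr0 -surjective_pairing.
move: P Q {PQ nP mE rP eP sle ws w_s} si sj eQ => [x y] [x' y'] si sj.
have s0 := sj (inord 0); have s1 := sj (inord 1).
have s2 := sj (inord 2); have s3 := sj (inord 3).
move: s0 s1 s2 s3 si => {sj wj wi}.
rewrite /side /kite_vertex -!val_eqE /= !inordK //=.
rewrite /lerp /=.
case: i => [[|[|[|[|//]]]]] //= _ s0 s1 s2 s3 si [ex ey];

  [move: {s0} (s1 isT) (s2 isT) (s3 isT) | move: {s1} (s0 isT) (s2 isT) (s3 isT)
  |move: {s2} (s0 isT) (s1 isT) (s3 isT)
  |move: {s3} (s0 isT) (s1 isT) (s2 isT)] => h0 h1 h2.
- have [ex' ey'] : x' = - 2 - x /\ y' = - y by split; lra.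
  by subst x' y'; constructor 1; split=> //; nra.
- have [ex' ey'] : x' = - x /\ y' = 2 - y by split; lra.
  by subst x' y'; constructor 2; split=> //; nra.
- have [ex' ey'] : x' = 2 * A - x /\ y' = - y by split; lra.
  by subst x' y'; constructor 3; split=> //; nra.
- have [ex' ey'] : x' = - x /\ y' = - 2 - y by split; lra.
  by subst x' y'; constructor 4; split=> //; nra.
Qed.

Lemma outer_billiardsP P Q : outer_billiards A P Q <-> tangent P Q.
Proof. by split=> [/outer_billiards_tangent|/tangent_outer_billiards]. Qed.
End Tangency.

(** * The path through the upper half plane *)

Section Dynamics.
Variables (R : realType) (A : R).
Hypothesis hA : 0 < A < 1.
Implicit Types (x y h u w s r : R) (P Q S : R * R).

Local Notation step := (outer_billiards2 A).
Local Notation good := (completely_defined_orbit A).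
Local Notation Xi := (@Xi R).

(** * Mirror symmetry and determinism of psi *)

Definition mirror P : R * R := (P.1, - P.2).

Lemma mirrorK : involutive mirror.
Proof. by case=> x y; rewrite /mirror /= opprK. Qed.

Lemma outer_billiards_mirror P Q :
  outer_billiards A P Q -> outer_billiards A (mirror Q) (mirror P).
Proof.
have /andP[A0 A1] := hA.
move=> /(outer_billiardsP hA) PQ; apply/(outer_billiardsP hA).
case: P PQ => x y [] [t1 t2 ->]; rewrite /mirror /=.
- by constructor 1; split; [lra|lra|congr pair; lra].
- by constructor 4; split; [lra|lra|congr pair; lra].
- by constructor 3; split; [lra|lra|congr pair; lra].
- by constructor 2; split; [lra|lra|congr pair; lra].
Qed.

Lemma outer_billiards_fun P Q S :
  outer_billiards A P Q -> outer_billiards A P S -> Q = S.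
Proof.
have /andP[A0 A1] := hA.
move=> /(outer_billiardsP hA) + /(outer_billiardsP hA).
case: P => x y [] [t1 t2 ->] [] [t3 t4 ->] //; exfalso; nra.
Qed.

Lemma outer_billiards_inj P Q S :
  outer_billiards A P S -> outer_billiards A Q S -> P = Q.
Proof.
move=> /outer_billiards_mirror + /outer_billiards_mirror.
by move=> /outer_billiards_fun /[apply] /(can_inj mirrorK).
Qed.

Lemma step_mirror P Q : step P Q -> step (mirror Q) (mirror P).
Proof. by move=> [S ? ?]; exists (mirror S); apply: outer_billiards_mirror. Qed.

Lemma step_fun P Q S : step P Q -> step P S -> Q = S.
Proof.
move=> [M PM MQ] [N PN NS]; have := outer_billiards_fun PM PN => eM; subst N.
exact: outer_billiards_fun MQ NS.
Qed.

Lemma good_next P : good P -> exists Q, step P Q.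
Proof.
move=> [u [<- uS]]; exists (u 2); exists (u 1); first exact: (uS 0).
exact: (uS 1).
Qed.

Lemma good_prev P : good P -> exists Q, step Q P.
Proof.
move=> [u [<- uS]]; exists (u (-2)); exists (u (-1)); first exact: (uS (-2)).
exact: (uS (-1)).
Qed.

Lemma good_step P Q : step P Q -> good P <-> good Q.
Proof.
move=> [S PS SQ]; split=> -[u [u0 uS]].
  exists (fun k => u (k + 2)); split=> [|k].
    apply: outer_billiards_fun SQ; have := uS 0; rewrite u0.
    by move=> /(outer_billiards_fun PS) ->; apply: (uS 1).
  by have := uS (k + 2); rewrite addrAC.
exists (fun k => u (k - 2)); split=> [|k].
  apply: outer_billiards_inj PS; have := uS (-1); rewrite addNr u0.
  by move=> /outer_billiards_inj /(_ SQ) <-; apply: (uS (-2)).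
by have := uS (k - 2); rewrite addrAC.
Qed.

Lemma good_mirror P : good P -> good (mirror P).
Proof.
move=> [u [u0 uS]]; exists (fun k => mirror (u (- k))); split; first by rewrite oppr0 u0.
move=> k; apply: outer_billiards_mirror; have := uS (- (k + 1)).
by rewrite opprD subrK.
Qed.

(** * Single steps of psi *)

Lemma step_via P M Q : tangent A P M -> tangent A M Q -> step P Q.
Proof. by move=> ? ?; exists M; apply/(outer_billiardsP hA). Qed.

Lemma step_right x y : -1 <= y -> y < x - 3 -> step (x, y) (x, y + 4).
Proof.
have /andP[A0 A1] := hA; move=> h1 h2; apply: (@step_via _ (- x, - 2 - y)).
  by constructor 4; split=> //; nra.
by constructor 2; split; [nra|nra|congr pair; lra].
Qed.

Lemma step_top_right x y : y > x - 3 -> x - A * y > A -> x + y > - 1 ->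
  step (x, y) (x - 2, y + 2).
Proof.
have /andP[A0 A1] := hA; move=> h1 h2 h3; apply: (@step_via _ (- x, - 2 - y)).
  by constructor 4; split=> //; lra.
by constructor 1; split; [nra|nra|congr pair; lra].
Qed.

Lemma step_top x y : x + A * y > A -> x - A * y < A -> x + y > 2 * A + 1 ->
  1 <= y -> step (x, y) (x - 2 * (1 + A), y).
Proof.
have /andP[A0 A1] := hA; move=> h1 h2 h3 h4; apply: (@step_via _ (2 * A - x, - y)).
  by constructor 3; split=> //; lra.
by constructor 1; split; [nra|nra|congr pair; lra].
Qed.

Lemma step_near x y : x + A * y > A -> x - A * y < A -> x + y < 2 * A + 1 ->
  1 <= y -> step (x, y) (x - 2 * A, y - 2).
Proof.
have /andP[A0 A1] := hA; move=> h1 h2 h3 h4; apply: (@step_via _ (2 * A - x, - y)).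
  by constructor 3; split=> //; lra.
by constructor 4; split; [nra|nra|congr pair; lra].
Qed.

Lemma step_top_left x y : x + A * y < A -> x + y > 3 ->
  step (x, y) (x - 2, y - 2).
Proof.
have /andP[A0 A1] := hA; move=> h1 h2; apply: (@step_via _ (- x, 2 - y)).
  by constructor 2; split=> //; nra.
by constructor 1; split; [nra|nra|congr pair; lra].
Qed.

Lemma step_left x y : x + A * y < A -> x + y < 3 -> 3 <= y ->
  step (x, y) (x, y - 4).
Proof.
have /andP[A0 A1] := hA; move=> h1 h2 h3; apply: (@step_via _ (- x, 2 - y)).
  by constructor 2; split=> //; nra.
by constructor 4; split; [nra|nra|congr pair; lra].
Qed.

(* The lines bounding the regions of the steps above: psi is undefined on
   them, and its inverse on those of the lemmas ending in start. *)
Ltac dead_end :=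
  have /andP[A0 A1] := hA;
  move=> [? /(outer_billiardsP hA) + /(outer_billiardsP hA)];
  case=> -[? ? ->] [] [? ? _]; nra.

Lemma dead_right x y Q : -1 <= y -> y = x - 3 -> ~ step (x, y) Q.
Proof. move=> h1 h2; dead_end. Qed.

Lemma dead_top_right x y Q : 1 <= y -> x - A * y = A -> ~ step (x, y) Q.
Proof. move=> h1 h2; dead_end. Qed.

Lemma dead_top x y Q : 1 <= y -> x + A * y = A -> ~ step (x, y) Q.
Proof. move=> h1 h2; dead_end. Qed.

Lemma dead_near x y Q : 1 <= y -> x + A * y > A -> x - A * y < A ->
  x + y = 2 * A + 1 -> ~ step (x, y) Q.
Proof. move=> h1 h2 h3 h4; dead_end. Qed.

Lemma dead_top_left x y Q : x + A * y < A -> x + y = 3 -> ~ step (x, y) Q.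
Proof. move=> h1 h2; dead_end. Qed.

Ltac dead_start := move=> /step_mirror; rewrite /mirror /=; dead_end.

Lemma dead_left_start x y Q : 1 <= y -> x + y = - 1 -> ~ step Q (x, y).
Proof. move=> h1 h2; dead_start. Qed.

Lemma dead_top_left_start x y Q : 1 <= y -> x + y > - 1 ->
  x + A * y = - 2 - A -> ~ step Q (x, y).
Proof. move=> h1 h2 h3; dead_start. Qed.

Lemma dead_near_start x y Q : -1 <= y -> x + y < - 1 ->
  x + A * y = - 3 * A -> ~ step Q (x, y).
Proof. move=> h1 h2 h3; dead_start. Qed.

Lemma dead_top_start x y Q : 1 <= y -> x + A * y > - 2 - A ->
  x - A * y = - 2 - A -> ~ step Q (x, y).
Proof. move=> h1 h2 h3; dead_start. Qed.

Lemma dead_top_right_start x y Q : 1 <= y -> y = x + 1 -> ~ step Q (x, y).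
Proof. move=> h1 h2; dead_start. Qed.

(** The start is exempt from avoiding [Xi], so a walk may leave from a point of [Xi]. *)
Inductive walk P : R * R -> Prop :=
| walk0 : walk P P
| walkS Q S : walk P Q -> step Q S -> ~ Xi S -> walk P S.

Lemma walk_trans P Q S : walk P Q -> walk Q S -> walk P S.
Proof. by move=> PQ; elim=> // S1 S2 _ PS1 st nS2; exact: walkS PS1 st nS2. Qed.

Lemma walk1 P S : step P S -> ~ Xi S -> walk P S.
Proof. by move=> st nS; apply: walkS st nS; apply: walk0. Qed.

Lemma walk_good P Q : walk P Q -> good P <-> good Q.
Proof. by elim=> // S1 S2 _ -> st _; apply: good_step st. Qed.

Lemma walkP P Q : walk P Q -> exists (n : nat) (u : nat -> R * R),
  [/\ u 0%N = P, u n = Q, forall k, (k < n)%N -> step (u k) (u k.+1) &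
      forall k, (0 < k <= n)%N -> ~ Xi (u k)].
Proof.
elim=> [|S1 S2 _ [n [u [u0 un uS nX]]] st nS2].
  by exists 0%N, (fun=> P); split=> // k; case: k.
exists n.+1, (fun k => if (k <= n)%N then u k else S2); split=> //=.
- by rewrite ltnn.
- move=> k; rewrite ltnS => kn; rewrite kn; case: (ltnP k n) => [|nk].
    by move/uS.
  have -> : k = n by apply/eqP; rewrite eqn_leq kn nk.
  by rewrite un.
- by move=> k /andP[k0 kn]; case: ifP => // kn'; apply: nX; rewrite k0.
Qed.

Lemma Xi_mirror P : Xi P -> Xi (mirror P).
Proof.
by case: P => x y [/= x0 [] ->]; split=> //=; [right|left; rewrite opprK].
Qed.

(** The second walk, mirrored and run backwards, leads from [Q] to [S]; since [Q] is outside [Xi],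
    the first walk has at least one step. *)
Lemma walk_first_return P Q S : Xi P -> Xi S -> ~ Xi Q ->
  walk P Q -> walk (mirror S) (mirror Q) -> first_return A P S.
Proof.
move=> XP XS XQ /walkP[n [u [u0 un uS uX]]] /walkP[m [v [v0 vm vS vX]]].
have n0 : (0 < n)%N.
  by rewrite lt0n; apply/eqP => e; apply: XQ; rewrite -un e u0.
pose t k := if (k <= n)%N then u k else mirror (v (n + m - k)%N).
have tn k : (n <= k)%N -> t k = mirror (v (n + m - k)%N).
  rewrite /t leq_eqVlt => /orP[/eqP <-|]; last by rewrite ltnNge => /negPf ->.
  by rewrite leqnn addKn vm un mirrorK.
exists (n + m)%N, t; split.
- by rewrite addn_gt0 n0.
- by split; [rewrite /t leq0n | rewrite tn ?leq_addr // subnn v0 mirrorK].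
- move=> k knm; case: (ltnP k n) => kn.
    by rewrite /t (ltnW kn) kn; apply: uS.
  rewrite !tn ?(leqW kn) //; apply: step_mirror.
  have -> : (n + m - k = (n + m - k.+1).+1)%N by lia.
  by apply: vS; lia.
- by split.
- move=> k /andP[k0 knm]; case: (leqP k n) => kn.
    by rewrite /t kn; apply: uX; rewrite k0.
  rewrite tn ?(ltnW kn) // => /Xi_mirror; rewrite mirrorK.
  by apply: vX; lia.
Qed.

Lemma first_return_fun P Q S : first_return A P Q -> first_return A P S -> Q = S.
Proof.
move=> [n [u [n0 [u0 un] uS [_ XQ] uX]]] [m [v [m0 [v0 vm] vS [_ XS] vX]]].
have uv k : (k <= n)%N -> (k <= m)%N -> u k = v k.
  elim: k => [|k IH] kn km; first by rewrite u0 v0.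
  have e := IH (ltnW kn) (ltnW km).
  by apply: (step_fun (uS _ kn)); rewrite e; apply: vS.
case: (ltngtP n m) => nm; last by rewrite -un -vm nm uv // nm.
- by case: (vX n); rewrite ?n0 // -uv ?(ltnW nm) // un.
- by case: (uX m); rewrite ?m0 // uv ?(ltnW nm) // vm.
Qed.

Lemma first_return_mirror P Q :
  first_return A P Q -> first_return A (mirror Q) (mirror P).
Proof.
move=> [n [u [n0 [u0 un] uS [XP XQ] uX]]].
exists n, (fun k => mirror (u (n - k)%N)); split=> //.
- by rewrite subn0 subnn u0 un.
- move=> k kn; apply: step_mirror.
  have -> : (n - k = (n - k.+1).+1)%N by lia.
  by apply: uS; lia.
- by split; apply: Xi_mirror.
- move=> k kn /Xi_mirror; rewrite mirrorK; apply: uX; lia.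
Qed.

(** * Runs of equal translations *)

Lemma walk_right x y n : -1 <= y -> y + 4 * n%:R < x + 1 ->
  walk (x, y) (x, y + 4 * n%:R).
Proof.
elim: n y => [|n IH] y y1 hn; first by rewrite mulr0 addr0; exact: walk0.
have n0 : 0 <= n%:R :> R by apply: ler0n.
move: hn; rewrite -(natr1 n) => hn.
have -> : y + 4 * (n%:R + 1) = y + 4 + 4 * n%:R by ring.
apply: walk_trans (IH _ _ _); [|lra|lra].
by apply: walk1; [apply: step_right => //; lra|rewrite /Xi /=; lra].
Qed.

(** From height [- 1] the first step lands at height 1, where [y > x - 3] makes the new abscissa
    negative; all other steps land at height 3 or more. Hence [Xi] is avoided. *)
Lemma walk_top_right x y n : y > x - 3 -> y = - 1 \/ 1 <= y -> x + y > - 1 ->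
  x - 2 * n%:R - A * (y + 2 * n%:R) - A > - 2 - 2 * A ->
  walk (x, y) (x - 2 * n%:R, y + 2 * n%:R).
Proof.
have /andP[A0 A1] := hA.
elim: n x y => [|n IH] x y h1 h2 h3 hn.
  by rewrite mulr0 addr0 subr0; apply: walk0.
have n0 : 0 <= n%:R :> R by apply: ler0n.
move: hn; rewrite -(natr1 n) => hn.
have -> : y + 2 * (n%:R + 1) = y + 2 + 2 * n%:R by ring.
have -> : x - 2 * (n%:R + 1) = x - 2 - 2 * n%:R by ring.
apply: walk_trans (IH _ _ _ _ _ _); [|lra|by right; lra|lra|lra].
apply: walk1; first by apply: step_top_right => //; nra.
by rewrite /Xi /=; lra.
Qed.

Lemma walk_top x y n : 1 <= y -> x - A * y < A ->
  x - 2 * (1 + A) * n%:R + A * y - A > - 2 - 2 * A ->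
  x - 2 * (1 + A) * n%:R + y - 3 > - 4 ->
  walk (x, y) (x - 2 * (1 + A) * n%:R, y).
Proof.
have /andP[A0 A1] := hA.
elim: n x => [|n IH] x h1 h2 h3 hn.
  by rewrite mulr0 subr0; apply: walk0.
have n0 : 0 <= n%:R :> R by apply: ler0n.
have An0 : 0 <= A * n%:R by apply: mulr_ge0 => //; apply: ltW.
move: h3 hn; rewrite -(natr1 n) => h3 hn.
have -> : x - 2 * (1 + A) * (n%:R + 1) = x - 2 * (1 + A) - 2 * (1 + A) * n%:R.
  by ring.
apply: walk_trans (IH _ _ _ _ _); [|lra|lra|lra|lra].
apply: walk1; first by apply: step_top => //; lra.
(* At height 1 the bound on [x] reads [x < 2 * A], so the image has negative abscissa. *)
by move=> [/= ? [] ?]; nra.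
Qed.

Lemma walk_top_left x y n : x + A * y < A ->
  x - 2 * n%:R + (y - 2 * n%:R) - 3 > - 4 ->
  walk (x, y) (x - 2 * n%:R, y - 2 * n%:R).
Proof.
have /andP[A0 A1] := hA.
elim: n x y => [|n IH] x y h1 hn.
  by rewrite mulr0 !subr0; apply: walk0.
have n0 : 0 <= n%:R :> R by apply: ler0n.
move: hn; rewrite -(natr1 n) => hn.
have -> : y - 2 * (n%:R + 1) = y - 2 - 2 * n%:R by ring.
have -> : x - 2 * (n%:R + 1) = x - 2 - 2 * n%:R by ring.
apply: walk_trans (IH _ _ _ _); [|lra|lra].
apply: walk1; first by apply: step_top_left => //; lra.
by move=> [/= ? _]; nra.
Qed.

Lemma walk_left x y n : x + A * y < A -> x + y < 3 -> y - 4 * n%:R >= - 1 ->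
  walk (x, y) (x, y - 4 * n%:R).
Proof.
have /andP[A0 A1] := hA.
elim: n y => [|n IH] y h1 h2 hn.
  by rewrite mulr0 subr0; apply: walk0.
have n0 : 0 <= n%:R :> R by apply: ler0n.
move: hn; rewrite -(natr1 n) => hn.
have -> : y - 4 * (n%:R + 1) = y - 4 - 4 * n%:R by ring.
apply: walk_trans (IH _ _ _ _); [|lra|lra|lra].
apply: walk1; first by apply: step_left => //; lra.
by move=> [/= ? _]; nra.
Qed.

(* The positions in the four strips after a, b, c and d translations; here
   y = h + 4 a. *)
Definition strips x y (b c d : R) : Prop :=
  [/\ 0 < y - x + 3 < 4,
      - 2 - 2 * A < x - 2 * b - A * (y + 2 * b) - A < 0,
      - 2 - 2 * A < x - 2 * b - 2 * (1 + A) * c + A * (y + 2 * b) - A < 0 &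
      - 4 < x - 2 * (1 + A) * c + y - 4 * d - 3 < 0].

(** * The half turn from right to left *)

Definition half_turn x h x' h' : Prop :=
  exists a b c d e : int,
    [/\ strips x (h + 4 * a%:~R) b%:~R c%:~R d%:~R,
        x' = x - 2 * b%:~R - 2 * (1 + A) * c%:~R - 2 * d%:~R &
        h' = h + 4 * a%:~R + 2 * b%:~R - 2 * d%:~R - 4 * e%:~R].

(* In the last case of the proof, the translation by (-2A, -2) replaces the last
   of the c translations and the first of the e translations. *)
Lemma half_turn_forward x h : 0 < x -> h = 1 \/ h = - 1 -> good (x, h) ->
  exists x' h', [/\ x' < 0, h' = 1 \/ h' = - 1, half_turn x h x' h' &
                    walk (x, h) (x', h')].
Proof.
have /andP[A0 A1] := hA; have LA : 0 < 2 + 2 * A by lra.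
move=> x0 hh gP.
have [a /andP[a1 a2]] : exists n : nat, - 4 < x - 3 - h - 4 * n%:R <= 0.
  by apply: nat_ceil; lra.
have [k kE] : exists k : int, h = 2 * k%:~R - 1.
  by case: hh => ->; [exists 1|exists 0]; lra.
have hl : - 1 <= h <= 1 by case: hh => ->; apply/andP; split; lra.
have an0 : 0 <= a%:R :> R by apply: ler0n.
have [y1 y1E] : exists y1, h + 4 * a%:R = y1 by eexists.
have y1m : y1 = -1 \/ 1 <= y1.
  case: (posnP a) => [a0|a_gt0].
    by move: y1E; rewrite a0; case: hh => ->; [right|left]; lra.
  have : 1 <= a%:R :> R by rewrite ler1n.
  by right; lra.
have {hh} y1l : - 1 <= y1 by case: y1m => ?; lra.
have w1 : walk (x, h) (x, y1).
  by rewrite -y1E; apply: walk_right => //; lra.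
have g1 := (walk_good w1).1 gP.
have u0 : x - 3 < y1.
  rewrite lt_neqAle; apply/andP; split; last lra.
  apply/eqP => /esym e; have [Q] := good_next g1; apply: dead_right => //; lra.
have [b /andP[b1 b2]] : exists n : nat,
    - (2 + 2 * A) < x - A * y1 - A - (2 + 2 * A) * n%:R <= 0.
  by apply: nat_ceil => //; case: y1m => [->|]; nra.
have bn0 : 0 <= b%:R :> R by apply: ler0n.
have [x2 x2E] : exists z, x - 2 * b%:R = z by eexists.
have [y2 y2E] : exists z, y1 + 2 * b%:R = z by eexists.
have y2m : 1 <= y2.
  case: y1m => y1m; last lra.
  (* With [b = 0] and height [- 1], the second strip would require [x <= 0]. *)
  case: (posnP b) => [b0|b_gt0]; first by move: b2; rewrite b0 y1m; lra.
  have : 1 <= b%:R :> R by rewrite ler1n.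
  lra.
have w2 : walk (x, h) (x2, y2).
  apply: walk_trans w1 _; rewrite -x2E -y2E; apply: walk_top_right => //; lra.
have {y1m} g2 := (walk_good w2).1 gP.
have w20 : x2 - A * y2 < A.
  rewrite lt_neqAle; apply/andP; split; last by rewrite -x2E -y2E; lra.
  by apply/eqP => e; have [Q] := good_next g2; apply: dead_top_right.
have w21 : x2 - A * y2 - A > - 2 - 2 * A by rewrite -x2E -y2E; lra.
have [c /andP[c1 c2]] : exists n : nat,
    - (2 + 2 * A) < x2 + A * y2 - A - (2 + 2 * A) * n%:R <= 0.
  by apply: nat_ceil => //; nra.
have cn0 : 0 <= c%:R :> R by apply: ler0n.
have [x3 x3E] : exists z, x2 - 2 * (1 + A) * c%:R = z by eexists.
(* Common end of both cases. Here [d] may be negative, and then [(x4, y4)] need not lie on the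
   orbit. *)
have fin x4 y4 (d : int) (e : nat) :
    x4 = x3 - 2 * d%:~R -> y4 = y2 - 2 * d%:~R ->
    x3 + A * y2 < A -> - 4 < x4 + y4 - 3 < 0 -> x4 < 0 ->
    y4 - 4 * e%:R = 1 \/ y4 - 4 * e%:R = - 1 ->
    walk (x, h) (x4, y4 - 4 * e%:R) ->
    exists x' h', [/\ x' < 0, h' = 1 \/ h' = - 1, half_turn x h x' h' &
                    walk (x, h) (x', h')].
  move=> x4E y4E s0 /andP[r0 r1] x40 h4 w4; exists x4, (y4 - 4 * e%:R); split=> //.
  exists a, b, c, d, e; rewrite -!pmulrn /strips y1E y2E x2E x3E.
  split; [split; apply/andP; split | |];
    move: y1E a1 a2 u0 w20 w21 c1 c2 s0 r0 r1; rewrite x4E y4E -?x3E -?x2E -?y2E;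
    clear; lra.
(* The last horizontal translation is a step of psi only if its image satisfies [x + y > - 1];
   otherwise the exceptional translation takes its place. *)
have [r|r] := ltP (- 4) (x3 + y2 - 3).
  have w3 : walk (x, h) (x3, y2).
    by apply: walk_trans w2 _; rewrite -x3E; apply: walk_top => //; lra.
  have g3 := (walk_good w3).1 gP.
  have s0 : x3 + A * y2 < A.
    rewrite lt_neqAle; apply/andP; split; last by lra.
    by apply/eqP => e; have [Q] := good_next g3; apply: dead_top.
  have [d /andP[d1 d2]] : exists n : nat, - 4 < x3 + y2 - 3 - 4 * n%:R <= 0.
    exact: nat_ceil.
  have dn0 : 0 <= d%:R :> R by apply: ler0n.
  have [x4 x4E] : exists z, x3 - 2 * d%:R = z by eexists.
  have [y4 y4E] : exists z, y2 - 2 * d%:R = z by eexists.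
  have w4 : walk (x, h) (x4, y4).
    by apply: walk_trans w3 _; rewrite -x4E -y4E; apply: walk_top_left => //; lra.
  have g4 := (walk_good w4).1 gP.
  have s4 : x4 + A * y4 < A.
    have : 0 <= A * d%:R by apply: mulr_ge0 => //; apply: ltW.
    by rewrite -x4E -y4E; lra.
  have r0 : x4 + y4 < 3.
    rewrite lt_neqAle; apply/andP; split; last by lra.
    by apply/eqP => e; have [Q] := good_next g4; apply: dead_top_left.
  have x40 : x4 < 0.
    have : 0 <= A * (y2 - 1) by apply: mulr_ge0; [exact: ltW|rewrite subr_ge0].
    by rewrite -x4E; move: s0 dn0; clear; lra.
  have [j jE] : exists j : int, y4 = 2 * j%:~R - 1.
    exists (k + 2 * a%:Z + b%:Z - d%:Z).
    by rewrite !(rmorphD, rmorphB, rmorphM) /= -!pmulrn -y4E -y2E -y1E kE; ring.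
  have [e eE] : exists e : nat, y4 - 4 * e%:R = 1 \/ y4 - 4 * e%:R = - 1.
    by rewrite jE; apply: odd_level; lra.
  apply: (@fin x4 y4 d e); rewrite -?pmulrn //.
    by apply/andP; split; move: d1 r0; rewrite -x4E -y4E; clear -A0; lra.
  have {eE} : - 1 <= y4 - 4 * e%:R by case: eE => ->; clear -A0; lra.
  by move=> ?; apply: walk_trans w4 _; apply: walk_left.
have s0 : x3 + A * y2 < A by nra.
(* For [c = 0] the sum [x3 + y2] is still [x + y1], which exceeds [- 1], against the present
   case. *)
have [c' cE] : exists c', c = c'.+1.
  case: c c1 c2 cn0 x3E fin => [|c'] ? ? ? x3E; last by exists c'.
  by exfalso; lra.
have c'n0 : 0 <= c'%:R :> R by apply: ler0n.
have x3E' : x2 - 2 * (1 + A) * c'%:R = x3 + 2 * (1 + A).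
  by rewrite -x3E cE -(natr1 c'); ring.
have w31 : x3 + 2 * (1 + A) - A * y2 < A.
  have : 0 <= A * c'%:R by apply: mulr_ge0 => //; apply: ltW.
  by rewrite -x3E'; move: w20 c'n0; clear; lra.
have w3 : walk (x, h) (x3 + 2 * (1 + A), y2).
  apply: walk_trans w2 _; rewrite -x3E'; apply: walk_top => //.
    by rewrite x3E'; lra.
  by rewrite x3E'; nra.
have g3 := (walk_good w3).1 gP.
have s31 : A < x3 + 2 * (1 + A) + A * y2 by move: c1 x3E; clear; lra.
have r4 : x3 + y2 - 3 < - 4.
  rewrite lt_neqAle r andbT; apply/eqP => e.
  by have [Q] := good_next g3; apply: dead_near => //; move: e; clear; lra.
have s34 : x3 + 2 + A * (y2 - 2) < A by move: r4 y2m A0 A1; clear; nra.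
have w4 : walk (x, h) (x3 + 2, y2 - 2).
  apply: walk_trans w3 _.
  have -> : x3 + 2 = x3 + 2 * (1 + A) - 2 * A by ring.
  apply: walk1; first by apply: step_near => //; move: r4; clear; lra.
  by move=> [/= ? _]; move: r4 y2m A0; lra.
have [j jE] : exists j : int, y2 - 2 = 2 * j%:~R - 1.
  exists (k + 2 * a%:Z + b%:Z - 1).
  by rewrite !(rmorphD, rmorphB, rmorphM) /= -!pmulrn -y2E -y1E kE; ring.
have [e eE] : exists e : nat, y2 - 2 - 4 * e%:R = 1 \/ y2 - 2 - 4 * e%:R = - 1.
  by rewrite jE; apply: odd_level; lra.
have en0 : 0 <= e%:R :> R by apply: ler0n.
have ee : y2 - 2 - 4 * e%:R = y2 + 2 - 4 * e.+1%:R by rewrite -(natr1 e); ring.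
(* The orbit passes through [(x3 + 2, y2 - 2)]; with [d = - 1] the formal height is 4 larger, which
   one extra vertical translation compensates. *)
apply: (@fin (x3 + 2) (y2 + 2) (-1) e.+1); rewrite -?ee.
- by rewrite rmorphN /=; ring.
- by rewrite rmorphN /=; ring.
- by [].
- by apply/andP; split; [move: y2m s31 A0 A1|move: r4]; clear; nra.
- by move: y2m r4 s34 A0; clear; nra.
- by [].
have {eE} : - 1 <= y2 - 2 - 4 * e%:R by case: eE => ->; clear -A0; lra.
by move=> ?; apply: walk_trans w4 _; apply: walk_left => //; move: s34 r4; clear; lra.
Qed.

(** Traced backwards, the ordinary and the exceptional path agree from the second strip on; this is
    their common part. *)
Lemma walk_from_Xi x2 y2 (j : int) : y2 = 2 * j%:~R - 1 -> 1 <= y2 ->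
    - 2 - 2 * A <= x2 - A * y2 - A < 0 -> - 1 < x2 + y2 ->
    - 2 - 2 * A < x2 + A * y2 - A -> good (x2, y2) ->
  exists x h (a b : nat), [/\ 0 < x, h = 1 \/ h = - 1,
    [/\ - 2 - 2 * A < x2 - A * y2 - A, 0 < h + 4 * a%:R - x + 3 < 4,
    x2 = x - 2 * b%:R & y2 = h + 4 * a%:R + 2 * b%:R] &
    walk (x, h) (x2, y2)].
Proof.
have /andP[A0 A1] := hA.
move=> jE y2l /andP[w1 w0] xy s2 g2.
have {}w1 : - 2 - 2 * A < x2 - A * y2 - A.
  rewrite lt_neqAle w1 andbT; apply/eqP => e.
  by have [Q] := good_prev g2; apply: dead_top_start => //; lra.
have [b /andP[b1 b2]] : exists n : nat, - 4 < y2 - x2 - 1 - 4 * n%:R <= 0.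
  by apply: nat_ceil => //; nra.
have bn0 : 0 <= b%:R :> R by apply: ler0n.
have [x1 x1E] : exists z, x2 + 2 * b%:R = z by eexists.
have [y1 y1E] : exists z, y2 - 2 * b%:R = z by eexists.
have {jE} y1j : y1 = 2 * (j - b%:Z)%:~R - 1.
  by rewrite rmorphB /= -pmulrn -y1E jE; ring.
(* The bounds [y1 > x1 - 3] and [x1 + y1 > - 1] give [y1 > - 2], and [y1] is odd. *)
have y1l : - 1 <= y1.
  have : (- 1)%:~R < (j - b%:Z)%:~R :> R by rewrite rmorphN /=; lra.
  rewrite ltr_int -[(j - _)%R](subrK 1) ltzD1 lerBrDr addrC subrr.
  by rewrite -(ler_int R) y1j => ?; lra.
have y1m : y1 = - 1 \/ 1 <= y1.
  have [j0|j0] := leP (j - b%:Z) 0.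
    left; have : (j - b%:Z)%:~R <= 0 :> R by rewrite lerz0.
    lra.
  right; have : 1 <= (j - b%:Z)%:~R :> R by rewrite ler1z.
  lra.
have w : walk (x1, y1) (x2, y2).
  have -> : x2 = x1 - 2 * b%:R by rewrite -x1E; ring.
  have -> : y2 = y1 + 2 * b%:R by rewrite -y1E; ring.
  by apply: walk_top_right => //; rewrite -x1E -y1E; lra.
have g1 := (walk_good w).2 g2.
have u4 : y1 - x1 + 3 < 4.
  rewrite lt_neqAle; apply/andP; split; last by lra.
  apply/eqP => e; have [Q] := good_prev g1.
  by apply: dead_top_right_start => //; [case: y1m => // ?; lra|lra].
have x10 : 0 < x1 by case: y1m => ?; lra.
have [a aE] : exists e : nat, y1 - 4 * e%:R = 1 \/ y1 - 4 * e%:R = - 1.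
  by rewrite y1j; apply: odd_level; lra.
exists x1, (y1 - 4 * a%:R), a, b; split=> //.
  by split=> //; [apply/andP; split|..]; lra.
apply: walk_trans w; rewrite -{2}[y1](subrK (4 * a%:R)).
by apply: walk_right => //; move: u4 aE; clear; lra.
Qed.

(** Of the second half of a return only the starting point is known, and its mirror image is the end
    of a half turn. *)
Lemma half_turn_backward x' h' : x' < 0 -> h' = 1 \/ h' = - 1 -> good (x', h') ->
  exists x h, [/\ 0 < x, h = 1 \/ h = - 1, half_turn x h x' h' &
                  walk (x, h) (x', h')].
Proof.
have /andP[A0 A1] := hA; have LA : 0 < 2 + 2 * A by lra.
move=> x0 hh gP.
have [e /andP[e1 e2]] : exists n : nat, - 4 < - x' - h' - 1 - 4 * n%:R <= 0.
  by apply: nat_ceil => //; case: hh => ->; lra.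
have en0 : 0 <= e%:R :> R by apply: ler0n.
have [y4 y4E] : exists y, h' + 4 * e%:R = y by eexists.
have y4m : y4 = 1 \/ exists2 e', e = S e' & 3 <= y4.
  case: (e) y4E e1 e2 => [|e'] y4E ? ?; first by left; case: hh => ?; lra.
  right; exists e' => //; have : 0 <= e'%:R :> R by apply: ler0n.
  move: y4E; rewrite -(natr1 e'); case: hh => ->; lra.
have [k kE] : exists k : int, y4 = 2 * k%:~R - 1.
  case: hh => hh; [exists (1 + 2 * e%:Z)|exists (2 * e%:Z)];
  by rewrite !(rmorphD, rmorphM) /= -!pmulrn -y4E hh; lra.
have h1 : - 1 <= h' by case: hh => ->; lra.
have {hh} y41 : 1 <= y4 by case: y4m => [->|[? _ ?]]; lra.
have fin x3 y3 x2 (c d : int) (j : int) : y3 = 2 * j%:~R - 1 ->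
    x' = x3 - 2 * d%:~R -> y4 = y3 - 2 * d%:~R ->
    x3 = x2 - 2 * (1 + A) * c%:~R -> 1 <= y3 ->
    - 2 - 2 * A < x3 + A * y3 - A < 0 -> - 4 < x' + y4 - 3 < 0 ->
    - 2 - 2 * A <= x2 - A * y3 - A < 0 -> - 1 < x2 + y3 ->
    - 2 - 2 * A < x2 + A * y3 - A ->
    walk (x2, y3) (x', h') ->
    exists x h, [/\ 0 < x, h = 1 \/ h = - 1, half_turn x h x' h' &
                  walk (x, h) (x', h')].
  move=> jE dx dy cx y3l /andP[s0 s1] /andP[r0 r1] w0 xy s2 w2.
  have g2 := (walk_good w2).2 gP.
  have [x [h [a [b [x_0 hh [w1 /andP[u0 u1] bx ay] w]]]]] :=
    walk_from_Xi jE y3l w0 xy s2 g2.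
  have /andP[_ w00] := w0.
  exists x, h; split=> //; last exact: walk_trans w w2.
  exists a, b, c, d, e; rewrite -!pmulrn /strips -ay -bx -cx; split;
    [split; apply/andP; split | |];
    move: y4E u0 u1 w1 w00 s0 s1 r0 r1; rewrite dx dy cx ?bx ?ay; clear; lra.
have r0 : - 4 <= x' + y4 - 3 by lra.
have r1 : x' + y4 - 3 < 0 by lra.
(* If the inequality fails, [(x', y4)] is only a formal point: the descent starts at [(x', y4 - 4)],
   reached by the exceptional translation. *)
have [s4|s4] := ltP (x' + A * y4) A.
  have w4 : walk (x', y4) (x', h').
    have -> : h' = y4 - 4 * e%:R by rewrite -y4E; ring.
    by apply: walk_left => //; lra.
  have g4 := (walk_good w4).2 gP.
  have {}r0 : - 4 < x' + y4 - 3.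
    rewrite lt_neqAle r0 andbT; apply/eqP => re; have [Q] := good_prev g4.
    by apply: dead_left_start => //; lra.
  have [d /andP[d1 d2]] : exists n : nat,
    - (2 + 2 * A) < - x' - A * y4 - 2 - A - (2 + 2 * A) * n%:R <= 0.
    by apply: nat_ceil => //; lra.
  have dn0 : 0 <= d%:R :> R by apply: ler0n.
  have [x3 x3E] : exists z, x' + 2 * d%:R = z by eexists.
  have [y3 y3E] : exists z, y4 + 2 * d%:R = z by eexists.
  have s0 : x3 + A * y3 < A by rewrite -x3E -y3E; move: d1; clear; lra.
  have s1 : - 2 - A <= x3 + A * y3 by rewrite -x3E -y3E; move: d2; clear; lra.
  have y3l : 1 <= y3 by lra.
  have w3 : walk (x3, y3) (x', h').
    apply: walk_trans w4.
    have -> : x' = x3 - 2 * d%:R by rewrite -x3E; ring.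
    have -> : y4 = y3 - 2 * d%:R by rewrite -y3E; ring.
    by apply: walk_top_left => //; lra.
  have g3 := (walk_good w3).2 gP.
  have {}s1 : - 2 - A < x3 + A * y3.
    rewrite lt_neqAle s1 andbT; apply/eqP => se; have [Q] := good_prev g3.
    by apply: dead_top_left_start => //; lra.
  have w30 : x3 - A * y3 - A < 0 by move: A0 s0 y3l; clear; nra.
  have [c /andP[c1 c2]] : exists n : nat,
    - (2 + 2 * A) < - x3 + A * y3 - 2 - A - (2 + 2 * A) * n%:R <= 0.
    by apply: nat_ceil => //; lra.
  have cn0 : 0 <= c%:R :> R by apply: ler0n.
  have Ac : 0 <= A * c%:R by apply: mulr_ge0 => //; apply: ltW.
  have [x2 x2E] : exists z, x3 + 2 * (1 + A) * c%:R = z by eexists.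
  have x3E' : x3 = x2 - 2 * (1 + A) * c%:R by rewrite -x2E; ring.
  apply: (@fin x3 y3 x2 c d (k + d%:Z)).
  - by rewrite rmorphD /= -pmulrn -y3E kE; ring.
  - by rewrite -pmulrn -x3E; ring.
  - by rewrite -pmulrn -y3E; ring.
  - by [].
  - by [].
  - by apply/andP; split; move: s0 s1; clear; lra.
  - by apply/andP; split.
  - by rewrite -x2E; apply/andP; split; move: c1 c2; clear; lra.
  - by rewrite -x2E; move: r0 x3E y3E dn0 cn0 Ac; clear; lra.
  - by rewrite -x2E; move: s1 cn0 Ac; clear; lra.
  apply: walk_trans w3; rewrite x3E'; apply: walk_top => //.
  - by rewrite -x2E; move: c1; clear; lra.
  - by rewrite -x3E'; move: s1; clear; lra.
  - by rewrite -x3E'; move: r0 x3E y3E dn0; clear; lra.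
have [e' eE y43] : exists2 e', e = S e' & 3 <= y4.
  by case: y4m => // y4e; exfalso; move: s4; rewrite y4e; lra.
have e'n0 : 0 <= e'%:R :> R by apply: ler0n.
have y4E' : y4 - 4 = h' + 4 * e'%:R by rewrite -y4E eE -(natr1 e'); ring.
have y43A : 3 * A <= A * y4 by move: A0 y43; clear; nra.
have s42 : x' + A * y4 - A < 2 * A by move: A1 y43 r1; clear; nra.
have w5 : walk (x', y4 - 4) (x', h').
  have -> : h' = y4 - 4 - 4 * e'%:R by rewrite y4E'; ring.
  by apply: walk_left => //; lra.
have g5 := (walk_good w5).2 gP.
have {}s4 : A < x' + A * y4.
  rewrite lt_neqAle s4 andbT; apply/eqP => se; have [Q] := good_prev g5.
  by apply: dead_near_start => //; lra.
have xy4 : 3 - 2 * A < x' + y4 by move: A1 y43 s4; clear; nra.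
have {}r0 : - 4 < x' + y4 - 3 by lra.
have w3 : walk (x' + 2 * A, y4 - 2) (x', h').
  apply: walk_trans w5; have -> : y4 - 4 = y4 - 2 - 2 by ring.
  rewrite -{2}[x'](addrK (2 * A)); apply: walk1; last by move=> [/= ? _]; lra.
  by apply: step_near => //; lra.
have [c /andP[c1 c2]] : exists n : nat,
  - (2 + 2 * A) < - (x' + 2 * A) + A * (y4 - 2) - 2 - A - (2 + 2 * A) * n%:R <= 0.
  by apply: nat_ceil => //; lra.
have cn0 : 0 <= c%:R :> R by apply: ler0n.
have Ac : 0 <= A * c%:R by apply: mulr_ge0 => //; apply: ltW.
have [x2 x2E] : exists z, x' + 2 * A + 2 * (1 + A) * c%:R = z by eexists.
(* A further horizontal translation from [(x' + 2 * A, y4 - 2)] would lead to abscissa [x' - 2]; it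
   is included in [c.+1] and corrected by [d = - 1]. *)
apply: (@fin (x' - 2) (y4 - 2) x2 c.+1 (- 1) (k - 1)).
- by rewrite rmorphB /= kE; ring.
- by rewrite rmorphN /=; ring.
- by rewrite rmorphN /=; ring.
- by rewrite -pmulrn -(natr1 c) -x2E; ring.
- by lra.
- by apply/andP; split; move: s4 s42 A1; clear; lra.
- by apply/andP; split.
- by rewrite -x2E; apply/andP; split; move: c1 c2; clear; lra.
- by rewrite -x2E; move: xy4 cn0 Ac; clear; lra.
- by rewrite -x2E; move: s4 A0 cn0 Ac; clear; lra.
apply: walk_trans w3.
have -> : x' + 2 * A = x2 - 2 * (1 + A) * c%:R by rewrite -x2E; ring.
apply: walk_top => //.
- by lra.
- by rewrite -x2E; move: c1; clear; lra.
- by rewrite -x2E; move: s4 A0; clear; lra.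
- by rewrite -x2E; move: xy4; clear; lra.
Qed.

(** * The linear system for the return displacement *)

Definition in_box u w s r : Prop :=
  [/\ 0 < u < 4, - 2 - 2 * A < w < 0, - 2 - 2 * A < s < 0 & - 4 < r < 0].

(* The second coordinate h matters only modulo 4. *)
Definition state x h u w s r : Prop :=
  in_box u w s r /\ exists a b c d : int,
  [/\ u = h + 4 * a%:~R - x + 3,
      w = x - 2 * b%:~R - A * (h + 4 * a%:~R + 2 * b%:~R) - A,
      s = x - 2 * b%:~R - 2 * (1 + A) * c%:~R
          + A * (h + 4 * a%:~R + 2 * b%:~R) - A &
      r = x - 2 * (1 + A) * c%:~R + (h + 4 * a%:~R) - 4 * d%:~R - 3].

(* Effect on the strips of passing from the path of (x, h) to the mirror path:
   dl, gm, bt are the increments of d, c, b, and 2 sg is that of the height at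
   which the fourth strip is entered. *)
Definition move_u u (sg dl gm bt : int) : R :=
  u + 2 * sg%:~R - 4 * bt%:~R - 2 * (1 + A) * gm%:~R.
Definition move_w w (sg dl gm bt : int) : R :=
  w + 2 * dl%:~R + 2 * (1 + A) * gm%:~R - 2 * A * (sg%:~R + dl%:~R).
Definition move_s s (sg dl gm bt : int) : R :=
  s + 2 * A * sg%:~R + 2 * (1 + A) * dl%:~R.
Definition move_r r (sg dl gm bt : int) : R := r + 2 * sg%:~R.

Definition move u w s r (sg dl gm bt : int) : Prop :=
  (sg = 1 \/ sg = - 1) /\
  in_box (move_u u sg dl gm bt) (move_w w sg dl gm bt)
         (move_s s sg dl gm bt) (move_r r sg dl gm bt).

Lemma state_shift x h u w s r x' h' u' w' s' r' :
    state x h u w s r -> state x' h' u' w' s' r' ->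
  exists a b c d : int,
  [/\ u' = u + (h' - h) - (x' - x) + 4 * a%:~R,
      w' = w + (x' - x) - 2 * b%:~R - A * ((h' - h) + 4 * a%:~R + 2 * b%:~R),
      s' = s + (x' - x) - 2 * b%:~R - 2 * (1 + A) * c%:~R
          + A * ((h' - h) + 4 * a%:~R + 2 * b%:~R) &
      r' = r + (x' - x) - 2 * (1 + A) * c%:~R + (h' - h + 4 * a%:~R) - 4 * d%:~R].
Proof.
move=> [_ [a [b [c [d [-> -> -> ->]]]]]] [_ [a' [b' [c' [d' [-> -> -> ->]]]]]].
exists (a' - a), (b' - b), (c' - c), (d' - d); rewrite !rmorphB /=.
by split; ring.
Qed.

Lemma return_state x h : Xi (x, h) -> good (x, h) ->
  exists u w s r (sg dl gm bt : int) x' h',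
  [/\ state x h u w s r, move u w s r sg dl gm bt,
      x' = x + 2 * bt%:~R + 2 * (1 + A) * gm%:~R + 2 * dl%:~R,
      exists j : int, h' = h + 2 * (dl + bt + 2 * j)%:~R &
      [/\ Xi (x', h'), first_return A (x, h) (x', h') &
      state x' (- h') (move_u u sg dl gm bt) (move_w w sg dl gm bt)
         (move_s s sg dl gm bt) (move_r r sg dl gm bt)]].
Proof.
have /andP[A0 A1] := hA.
move=> Xx gP; have [/= x0 hh] := Xx.
have [xl [hl [xl0 hhl H1 W1]]] := half_turn_forward x0 hh gP.
have gl := (walk_good W1).1 gP.
have hhl' : - hl = 1 \/ - hl = -1.
  by case: hhl => ->; [right|left; rewrite opprK].
have [x' [h' [x'0 hh' H2 W2]]] := half_turn_backward xl0 hhl' (good_mirror gl).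
have Xx' : Xi (x', - h').
  by split=> //=; case: hh' => ->; [right|left; rewrite opprK].
have FR : first_return A (x, h) (x', - h').
  apply: (@walk_first_return _ (xl, hl)) => //.
    by move=> [/= ? _]; lra.
  by rewrite /mirror /= opprK.
have [a [b [c [d [e [T1 xlE hlE]]]]]] := H1.
have [a' [b' [c' [d' [e' [T2 xlE' hlE']]]]]] := H2.
(* The heights of entry into the fourth strip are [hl] and [- hl] modulo 4, so [sg] is odd. Both
   paths end at abscissa [xl], so the two values of [r] differ by [2 * sg], which is less than 4 in
   absolute value. *)
have [sg [sgE sg1]] : exists sg : int,
    h' + 4 * a'%:~R + 2 * b'%:~R - 2 * d'%:~R =
    h + 4 * a%:~R + 2 * b%:~R - 2 * d%:~R + 2 * sg%:~R /\ (sg = 1 \/ sg = -1).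
  have [k kE] : exists k : int, hl = 1 - 2 * k%:~R.
    by case: hhl => ->; [exists 0|exists 1]; lra.
  have E : h' + 4 * a'%:~R + 2 * b'%:~R - 2 * d'%:~R =
    h + 4 * a%:~R + 2 * b%:~R - 2 * d%:~R + 2 * (2 * (e' - e + k) - 1)%:~R.
    by rewrite !(rmorphD, rmorphB, rmorphM) /=; lra.
  exists (2 * (e' - e + k) - 1); split=> //.
  have [/andP[? ?] _ _ /andP[r0 r1]] := T1; have [_ _ _ /andP[r0' r1']] := T2.
  have : [\/ 2 * (e' - e + k) - 1 = -1, 2 * (e' - e + k) - 1 = 0 |
              2 * (e' - e + k) - 1 = 1].
    apply: (@small_int R _ 2) => //; lra.
  by clear; case; lia.
have [dl dlE] : exists dl, dl = d' - d by eexists.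
have [gm gmE] : exists gm, gm = c' - c by eexists.
have [bt btE] : exists bt, bt = b' - b by eexists.
have {dlE} d'E : d'%:~R = d%:~R + dl%:~R :> R by rewrite dlE rmorphB /= addrC subrK.
have {gmE} c'E : c'%:~R = c%:~R + gm%:~R :> R by rewrite gmE rmorphB /= addrC subrK.
have {btE} b'E : b'%:~R = b%:~R + bt%:~R :> R by rewrite btE rmorphB /= addrC subrK.
have x'E : x' = x + 2 * bt%:~R + 2 * (1 + A) * gm%:~R + 2 * dl%:~R.
  by move: xlE xlE'; rewrite d'E c'E b'E => ->; lra.
have yE : h' + 4 * a'%:~R = h + 4 * a%:~R + 2 * sg%:~R + 2 * dl%:~R - 2 * bt%:~R.
  by move: sgE; rewrite d'E b'E; lra.
pose u := h + 4 * a%:~R - x + 3.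
pose w := x - 2 * b%:~R - A * (h + 4 * a%:~R + 2 * b%:~R) - A.
pose s := x - 2 * b%:~R - 2 * (1 + A) * c%:~R
          + A * (h + 4 * a%:~R + 2 * b%:~R) - A.
pose r := x - 2 * (1 + A) * c%:~R + (h + 4 * a%:~R) - 4 * d%:~R - 3.
have uE : move_u u sg dl gm bt = h' + 4 * a'%:~R - x' + 3.
  by rewrite yE x'E /move_u /u; ring.
have wE : move_w w sg dl gm bt =
    x' - 2 * b'%:~R - A * (h' + 4 * a'%:~R + 2 * b'%:~R) - A.
  by rewrite yE x'E b'E /move_w /w; ring.
have sE : move_s s sg dl gm bt = x' - 2 * b'%:~R - 2 * (1 + A) * c'%:~R
          + A * (h' + 4 * a'%:~R + 2 * b'%:~R) - A.
  by rewrite yE x'E b'E c'E /move_s /s; ring.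
have rE : move_r r sg dl gm bt =
    x' - 2 * (1 + A) * c'%:~R + (h' + 4 * a'%:~R) - 4 * d'%:~R - 3.
  by rewrite yE x'E c'E d'E /move_r /r; ring.
have B1 : in_box u w s r by exact: T1.
have B2 : in_box (move_u u sg dl gm bt) (move_w w sg dl gm bt)
         (move_s s sg dl gm bt) (move_r r sg dl gm bt).
  by rewrite uE wE sE rE; exact: T2.
exists u, w, s, r, sg, dl, gm, bt, x', (- h'); split=> //.
- by split=> //; exists a, b, c, d.
- have [i iE] : exists i : int, h + sg%:~R = 2 * i%:~R.
    by case: hh => ->; case: sg1 => ->; [exists 1|exists 0|exists 0|exists (-1)]; lra.
  exists (a' - a - i - dl).
  by rewrite !(rmorphD, rmorphB, rmorphM) /=; lra.
- split=> //; rewrite opprK; split=> //; exists a', b', c', d'.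
  by rewrite uE wE sE rE.
Qed.

(* The quadruples (sg, dl, gm, bt). *)
Definition moves : seq (int * int * int * int) :=
  [:: (1, 0, 0, 0); (1, 0, 0, 1); (1, 0, 1, 0); (1, 0, 1, -1);
      (1, -1, 0, 0); (1, -1, 0, 1); (1, -1, 1, 0); (1, -1, 1, -1);
      (-1, 0, 0, 0); (-1, 0, 0, -1); (-1, 0, -1, 0); (-1, 0, -1, 1);
      (-1, 1, 0, 0); (-1, 1, 0, -1); (-1, 1, -1, 0); (-1, 1, -1, 1)].

(** The system is triangular: given [sg], the third strip bounds [dl], then the second bounds [gm],
    then the first bounds [bt]. Each new integer is multiplied by the width of its strip, so two
    values remain for each. *)
Lemma move_cases u w s r sg dl gm bt : in_box u w s r ->
  move u w s r sg dl gm bt -> (sg, dl, gm, bt) \in moves.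
Proof.
have /andP[A0 A1] := hA.
move=> [/andP[u0 u1] /andP[w0 w1] /andP[s0 s1] _] [sgE].
rewrite /in_box /move_u /move_w /move_s.
move=> [/andP[u2 u3] /andP[w2 w3] /andP[s2 s3] _].
have LA : 0 < 2 * (1 + A) by lra.
case: sgE u2 u3 w2 w3 s2 s3 => ->; rewrite ?rmorphN /= => u2 u3 w2 w3 s2 s3;
(have [ddl|ddl|ddl] : [\/ dl = -1, dl = 0 | dl = 1] by
   apply: (small_int LA); move: s0 s1 s2 s3 A0 A1; clear; lra);
subst dl; move: s2 s3 w2 w3; rewrite ?rmorphN /= => s2 s3 w2 w3;
try (by exfalso; move: s0 s1 s2 s3 A0 A1; clear; lra); clear s0 s1 s2 s3;
(have [ddl|ddl|ddl] : [\/ gm = -1, gm = 0 | gm = 1] by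
   apply: (small_int LA); move: w0 w1 w2 w3 A0 A1; clear; lra);
subst gm; move: w2 w3 u2 u3; rewrite ?rmorphN /= => w2 w3 u2 u3;
try (by exfalso; move: w0 w1 w2 w3 A0 A1; clear; lra); clear w0 w1 w2 w3;
(have [ddl|ddl|ddl] : [\/ bt = -1, bt = 0 | bt = 1] by
   apply: (@small_int _ _ (4 : R)); move: u0 u1 u2 u3 A0 A1; clear; lra);
subst bt; move: u2 u3; rewrite ?rmorphN /= => u2 u3;
try (by exfalso; move: u0 u1 u2 u3 A0 A1; clear; lra); by [].
Qed.

(** The bounds for the four diagonals are complementary: [u] separates NE from SE and SW from NW,
    [w] separates NE from NW and SW from SE. *)
Lemma move_NE u w s r : move u w s r 1 0 1 0 ->
  2 * A < u /\ w < - 2.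
Proof.
move=> [_]; rewrite /move_u /move_w.
by move=> [/andP[? _] /andP[_ ?] _ _]; split; lra.
Qed.

Lemma move_SW u w s r : move u w s r (-1) 0 (-1) 0 ->
  u < 4 - 2 * A /\ - 2 * A < w.
Proof.
move=> [_]; rewrite /move_u /move_w ?rmorphN /=.
by move=> [/andP[_ ?] /andP[? _] _ _]; split; lra.
Qed.

Lemma move_SE u w s r : move u w s r 1 (-1) 1 (-1) ->
  u < 2 * A /\ w < - 2 * A.
Proof.
move=> [_]; rewrite /move_u /move_w ?rmorphN /=.
by move=> [/andP[_ ?] /andP[_ ?] _ _]; split; lra.
Qed.

Lemma move_NW u w s r : move u w s r (-1) 1 (-1) 1 ->
  4 - 2 * A < u /\ - 2 < w.
Proof.
move=> [_]; rewrite /move_u /move_w ?rmorphN /=.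
by move=> [/andP[? _] /andP[? _] _ _]; split; lra.
Qed.

(** Lattice coordinates of the displacement: [2 * bt + 2 * (1 + A) * gm + 2 * dl] is
    [2 * A * gm + 2 * (bt + gm + dl)]. *)
Definition displacement (m : int * int * int * int) : int * int :=
  let: (sg, dl, gm, bt) := m in (gm, bt + gm + dl).

Definition backtracks : seq ((int * int * int * int) * (int * int * int * int)) :=
  [seq mm <- [seq (m, m') | m <- moves, m' <- moves] |
    (displacement mm.1 != 0) && (displacement mm.2 == - displacement mm.1)].

(** The primed state is the arrival state with the height shifted by [2 * t], and [b], [c]
    renormalise the second and third strips. For [t = 0] the negated move would be a solution. *)
Lemma no_backtrack u w s r sg dl gm bt u' w' s' r' sg' dl' gm' bt' (t b c : int) :
  in_box u w s r -> move u w s r sg dl gm bt ->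
  in_box u' w' s' r' -> move u' w' s' r' sg' dl' gm' bt' ->
  t <> 0 ->
  u' = move_u u sg dl gm bt + 2 * t%:~R ->
  w' = move_w w sg dl gm bt - 2 * A * t%:~R - 2 * (1 + A) * b%:~R ->
  s' = move_s s sg dl gm bt + 2 * A * t%:~R - 2 * (1 - A) * b%:~R
         - 2 * (1 + A) * c%:~R ->
  displacement (sg', dl', gm', bt') = - displacement (sg, dl, gm, bt) ->
  displacement (sg, dl, gm, bt) = 0.
Proof.
have /andP[A0 A1] := hA.
move=> B1 M1 B2 M2 t0 ut wt st disp.
have m1 := move_cases B1 M1; have m2 := move_cases B2 M2.
apply/eqP/negPn/negP => disp0.
have : ((sg, dl, gm, bt), (sg', dl', gm', bt')) \in backtracks.
  rewrite mem_filter; apply/andP; split.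
    by apply/andP; split; [exact: disp0|apply/eqP; exact: disp].
  by apply/allpairsP; exists ((sg, dl, gm, bt), (sg', dl', gm', bt')).
move: B1 M1 B2 M2 => {m1 m2 disp disp0}.
move=> [/andP[u0 u1] /andP[w0 w1] /andP[s0 s1] _] [_].
move=> [/andP[u2 u3] /andP[w2 w3] /andP[s2 s3] _].
move=> [/andP[u4 u5] /andP[w4 w5] /andP[s4 s5] _] [_].
move=> [/andP[u6 u7] /andP[w6 w7] /andP[s6 s7] _].
have {t0} t1 : t = - 1 \/ t = 1.
  have [->|e|->] : [\/ t = -1, t = 0 | t = 1]; [|by left|by []|by right].
  by apply: (@small_int _ _ 2) => //; move: ut u2 u3 u4 u5; clear; lra.
have bE : backtracks = [:: ((1, 0, 0, 1), (1, -1, 0, 0));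
      ((1, 0, 0, 1), (-1, 0, 0, -1));
      ((1, 0, 1, 0), (-1, 0, -1, 0));
      ((1, 0, 1, -1), (-1, 0, -1, 1));
      ((1, 0, 1, -1), (-1, 1, -1, 0));
      ((1, -1, 0, 0), (1, 0, 0, 1));
      ((1, -1, 0, 0), (-1, 1, 0, 0));
      ((1, -1, 1, 0), (-1, 0, -1, 1));
      ((1, -1, 1, 0), (-1, 1, -1, 0));
      ((1, -1, 1, -1), (-1, 1, -1, 1));
      ((-1, 0, 0, -1), (1, 0, 0, 1));
      ((-1, 0, 0, -1), (-1, 1, 0, 0));
      ((-1, 0, -1, 0), (1, 0, 1, 0));
      ((-1, 0, -1, 1), (1, 0, 1, -1));
      ((-1, 0, -1, 1), (1, -1, 1, 0));
      ((-1, 1, 0, 0), (1, -1, 0, 0));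
      ((-1, 1, 0, 0), (-1, 0, 0, -1));
      ((-1, 1, -1, 0), (1, 0, 1, -1));
      ((-1, 1, -1, 0), (1, -1, 1, 0));
      ((-1, 1, -1, 1), (1, -1, 1, -1))] by [].
rewrite {}bE.
do 20?[rewrite in_cons => /predU1P[[? ? ? ? ? ? ? ?]|];
  [subst sg dl gm bt sg' dl' gm' bt'|]]; last by rewrite in_nil.
(* For each of the 20 pairs the widths confine [t] to 1 and [- 1], then [b] and [c] to three values;
   the strips are tested in the order [u], [w], [s] until a contradiction appears. *)
all: rewrite /move_u ?rmorphN /= in ut u2 u3 u6 u7.
all: case: t1 => ?; subst t; rewrite ?rmorphN /= in ut.
all: try (by exfalso; move: ut u0 u1 u2 u3 u4 u5 u6 u7 A0 A1; clear; lra).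
all: clear ut u0 u1 u2 u3 u4 u5 u6 u7.
all: rewrite /move_w ?rmorphN /= in wt w2 w3 w6 w7.
all: have [?|?|?] : [\/ b = -1, b = 0 | b = 1];
  [by apply: (@small_int _ _ (2 * (1 + A)));
   move: wt w0 w1 w2 w3 w4 w5 w6 w7 A0 A1; clear; lra
  |subst b|subst b|subst b]; rewrite ?rmorphN /= in wt.
all: try (by exfalso; move: wt w0 w1 w2 w3 w4 w5 w6 w7 A0 A1; clear; lra).
all: clear wt w0 w1 w2 w3 w4 w5 w6 w7.
all: rewrite /move_s ?rmorphN /= in st s2 s3 s6 s7.
all: have [?|?|?] : [\/ c = -1, c = 0 | c = 1];
  [by apply: (@small_int _ _ (2 * (1 + A)));
   move: st s0 s1 s2 s3 s4 s5 s6 s7 A0 A1; clear; lra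
  |subst c|subst c|subst c]; rewrite ?rmorphN /= in st.
all: by exfalso; move: st s0 s1 s2 s3 s4 s5 s6 s7 A0 A1; clear; lra.
Qed.
End Dynamics.

(** * The arithmetic graph *)

Section Lattice.
Variables (R : realType) (A alpha : R).
Hypothesis hA : 0 < A < 1.
Hypothesis hwd : arith_graph_well_defined A alpha.
Implicit Types (p q : int * int).

Local Notation Xi := (@Xi R).
Local Notation M := (M_map A alpha).
Local Notation arrow := (arith_arrow A alpha).

(** * Heights modulo 4 and injectivity of [M_map] *)

Lemma int_parity (k : int) : exists j : int, k = 2 * j \/ k = 2 * j + 1.
Proof. by exists (k %/ 2)%Z; lia. Qed.

(** Modulo 4 the sign is linear in the lattice coordinates, and states see the height only modulo
    4. *)
Lemma level_sign (k : int) :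
  ((-1) ^ (k + 1) = 1 :> R \/ (-1) ^ (k + 1) = -1 :> R) /\
  exists i : int, (-1) ^ (k + 1) = (2 * k - 1 + 4 * i)%:~R :> R.
Proof.
have ev (j : int) : (-1) ^ (2 * j) = 1 :> R.
  by rewrite -exprz_exp -exprnP sqrrN expr1n exp1rz.
have n1 : (-1 : R) != 0 by rewrite oppr_eq0 oner_eq0.
have [j [->|->]] := int_parity k.
  rewrite expfzDr // ev mul1r expr1z; split; [by right|exists (- j)].
  have -> : 2 * (2 * j) - 1 + 4 * - j = -1 :> int by lia.
  by rewrite mulrN1z.
have -> : 2 * j + 1 + 1 = 2 * (j + 1) by lia.
rewrite ev; split; [by left|exists (- j)].
by have -> : 2 * (2 * j + 1) - 1 + 4 * - j = 1 :> int by lia.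
Qed.

Lemma M_displacement p (dl gm bt j : int) (x' h' : R) :
  x' = (M p).1 + 2 * bt%:~R + 2 * (1 + A) * gm%:~R + 2 * dl%:~R ->
  h' = (M p).2 + 2 * (dl + bt + 2 * j)%:~R -> h' = 1 \/ h' = -1 ->
  M (p + (gm, bt + gm + dl)) = (x', h').
Proof.
case: p => m n; rewrite /M_map /= => -> h'E hh; congr pair.
  by rewrite !rmorphD /=; ring.
have [_ [i iE]] := level_sign (m + n).
have [hh2 [i' i'E]] := level_sign (m + gm + (n + (bt + gm + dl))).
(* Both heights are 1 or [- 1], so congruence modulo 4 makes them equal. *)
have [z zE] : exists z : int,
    h' - (-1) ^ (m + gm + (n + (bt + gm + dl)) + 1) = 4 * z%:~R.
  exists (j + i - gm - i').
  rewrite h'E iE i'E !(rmorphD, rmorphB, rmorphM, rmorphN) /=; ring.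
have z1 : (- 1)%:~R < z%:~R :> R.
  by rewrite mulrN1z; case: hh hh2 zE => -> [] ->; lra.
have z2 : z%:~R < 1%:~R :> R.
  by rewrite mulr1z; case: hh hh2 zE => -> [] ->; lra.
rewrite !ltr_int in z1 z2.
have z00 : z = 0 by lia.
by move: zE; rewrite z00 mulr0 => /eqP; rewrite subr_eq0 => /eqP.
Qed.

(** For rational [A] the map is not injective on the whole lattice. Within distance 2 the only
    coincidence of abscissas at distinct points has differences 2 and [- 1] up to sign, with [A] one
    half, and then the heights differ. *)
Lemma M_inj p q : `|p.1 - q.1| <= 2 -> `|p.2 - q.2| <= 2 -> M p = M q -> p = q.
Proof.
have /andP[A0 A1] := hA.
case: p q => [m n] [m' n'] /= dm dn [e1 e2].
have [_ [i iE]] := level_sign (m + n).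
have [_ [i' i'E]] := level_sign (m' + n').
have : (2 * (m + n) - 1 + 4 * i)%:~R = (2 * (m' + n') - 1 + 4 * i')%:~R :> R.
  by rewrite -iE -i'E.
move=> /intr_inj e3.
have e4 : A * (m - m')%:~R + (n - n')%:~R = 0 by rewrite !rmorphB /=; lra.
have [d [d' [dE d'E]]] : exists d d', m - m' = d /\ n - n' = d' by do 2!eexists.
rewrite dE d'E in dm dn e4.
have dd : exists z : int, d + d' = 2 * z by exists (i' - i); lia.
have dcase : d = -2 \/ d = -1 \/ d = 0 \/ d = 1 \/ d = 2 by lia.
have ncase : d' = -2 \/ d' = -1 \/ d' = 0 \/ d' = 1 \/ d' = 2 by lia.
case: dd => z zE.
have [d0 d'0] : d = 0 /\ d' = 0.
  case: dcase zE e4 {dE} => [->|[->|[->|[->|->]]]];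
  case: ncase {d'E dn} => [->|[->|[->|[->|->]]]] zE;
  rewrite ?rmorphN /= => e4; try (by exfalso; lra); by lia.
by congr pair; lia.
Qed.

Lemma enormP (c : int * int) :
  (enorm (lattice_point R c) <= Num.sqrt 2) = (`|c.1| <= 1) && (`|c.2| <= 1).
Proof.
rewrite /enorm /lattice_point /= ler_sqrt //.
have -> : (c.1%:~R ^+ 2 + c.2%:~R ^+ 2 <= 2 :> R) = (c.1 ^+ 2 + c.2 ^+ 2 <= 2).
  by rewrite -(ler_int R) rmorphD !rmorphXn.
by case: c => a b /=; apply/idP/idP; nia.
Qed.

Lemma displacement_small m : m \in moves ->
  (`|(displacement m).1| <= 1) && (`|(displacement m).2| <= 1).
Proof.
have /allP : all (fun m =>
  (`|(displacement m).1| <= 1) && (`|(displacement m).2| <= 1)) moves.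
  by [].
exact.
Qed.

(** * Arrows and their states *)

Lemma arrow_close p q : arrow p q -> `|p.1 - q.1| <= 1 /\ `|p.2 - q.2| <= 1.
Proof. by case=> _ _ _; rewrite enormP => /andP. Qed.

Lemma arrow_exists p : Xi (M p) ->
  exists u w s r (sg dl gm bt : int),
  let q := p + displacement (sg, dl, gm, bt) in
  [/\ state A (M p).1 (M p).2 u w s r, move A u w s r sg dl gm bt, arrow p q &
      state A (M q).1 (- (M q).2) (move_u A u sg dl gm bt)
        (move_w A w sg dl gm bt) (move_s A s sg dl gm bt) (move_r r sg dl gm bt)].
Proof.
move=> Xp; have gp := hwd Xp.
have [u [w [s [r [sg [dl [gm [bt [x' [h' [S Mv x'E [j jE] [Xx' FR S']]]]]]]]]]]] :=
  return_state hA Xp gp.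
exists u, w, s, r, sg, dl, gm, bt => q.
have Mq : M q = (x', h') by apply: M_displacement x'E jE _; case: Xx'.
have small := displacement_small (move_cases hA S.1 Mv).
split=> //; last by rewrite Mq.
split=> //; [by rewrite Mq|by rewrite Mq|].
rewrite enormP /q opprD addNKr.
by move: small; rewrite /displacement /= !normrN.
Qed.

(** The return from the mirror image of [M q], mirrored and reversed, ends at [M q]. *)
Lemma arrow_exists_before q : Xi (M q) -> exists p, arrow p q.
Proof.
move=> Xq; have gq := good_mirror hA (hwd Xq).
have [u [w [s [r [sg [dl [gm [bt [x' [h' [S Mv x'E [j jE] [Xx' FR S']]]]]]]]]]]] :=
  return_state hA (Xi_mirror Xq) gq.
exists (q + displacement (sg, dl, gm, bt)).
have Mp : M (q + displacement (sg, dl, gm, bt)) = mirror (x', h').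
  apply: (@M_displacement q dl gm bt (- (dl + bt) - j)); first exact: x'E.
    rewrite jE !(rmorphD, rmorphB, rmorphM, rmorphN) /=; ring.
  by case: (Xi_mirror Xx').
have small := displacement_small (move_cases hA S.1 Mv).
split=> //; [by rewrite Mp; apply: Xi_mirror| |].
  by rewrite Mp -[M q]mirrorK; apply: first_return_mirror.
by rewrite enormP addrC addKr.
Qed.

Lemma arrow_fun p q q' : arrow p q -> arrow p q' -> q = q'.
Proof.
move=> pq pq'; have [c1 c2] := arrow_close pq; have [c3 c4] := arrow_close pq'.
case: pq pq' => _ _ F _ [_ _ F' _].
by apply: M_inj; [lia|lia|exact: first_return_fun F F'].
Qed.

Lemma arrow_inj p p' q : arrow p q -> arrow p' q -> p = p'.
Proof.
move=> pq pq'; have [c1 c2] := arrow_close pq; have [c3 c4] := arrow_close pq'.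
case: pq pq' => _ _ F _ [_ _ F' _].
apply: M_inj; [lia|lia|].
apply: (can_inj (@mirrorK R)).
exact: first_return_fun (first_return_mirror hA F) (first_return_mirror hA F').
Qed.

Lemma arrow_state p q : arrow p q ->
  exists u w s r (sg dl gm bt : int),
  [/\ q = p + displacement (sg, dl, gm, bt),
      state A (M p).1 (M p).2 u w s r, move A u w s r sg dl gm bt &
      state A (M q).1 (- (M q).2) (move_u A u sg dl gm bt)
        (move_w A w sg dl gm bt) (move_s A s sg dl gm bt) (move_r r sg dl gm bt)].
Proof.
move=> pq; have [Xp _ _ _] := pq.
have [u [w [s [r [sg [dl [gm [bt [S Mv pq' S']]]]]]]]] := arrow_exists Xp.
exists u, w, s, r, sg, dl, gm, bt.
by have e := arrow_fun pq pq'; rewrite -e in S'; split.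
Qed.

Lemma arrow_no_backtrack p q : arrow p q -> arrow q p -> p = q.
Proof.
move=> pq qp.
have [u [w [s [r [sg [dl [gm [bt [qE S Mv S']]]]]]]]] := arrow_state pq.
have [u2 [w2 [s2 [r2 [sg2 [dl2 [gm2 [bt2 [pE S2 Mv2 _]]]]]]]]] := arrow_state qp.
have [_ [_ Xq] _ _] := pq.
have [z zE] : exists z : int, (M q).2 = z%:~R /\ (z = 1 \/ z = -1).
  by case: Xq => ->; [exists 1|exists (-1)]; split; [|left| |right].
case: zE => zE z1.
have [a [b [c [d [ua wb sc _]]]]] := state_shift S' S2.
have {}pE : displacement (sg2, dl2, gm2, bt2) = - displacement (sg, dl, gm, bt).
  by apply: (addrI q); rewrite -pE qE addrK.
(* The arrival state is taken at height [- z], the departure state at [z]. Their heights differ by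
   [2 * (z + 2 * a)], and [z + 2 * a] is odd, hence nonzero. *)
have := @no_backtrack _ _ hA _ _ _ _ _ _ _ _ _ _ _ _ _ _ _ _ (z + 2 * a) b c
  S.1 Mv S2.1 Mv2 _ _ _ _ pE.
move=> h; rewrite qE h ?addr0 //.
- by lia.
- by rewrite ua zE !(rmorphD, rmorphM) /=; ring.
- by rewrite wb zE !(rmorphD, rmorphM) /=; ring.
- by rewrite sc zE !(rmorphD, rmorphM) /=; ring.
Qed.

(** Each diagonal displacement comes from one move only, whereas a horizontal or vertical one comes
    from two. *)
Lemma displacement_diagonal m : m \in moves ->
  [/\ displacement m = (1, 1) -> m = (1, 0, 1, 0),
      displacement m = (-1, -1) -> m = (-1, 0, -1, 0),
      displacement m = (1, -1) -> m = (1, -1, 1, -1) &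
      displacement m = (-1, 1) -> m = (-1, 1, -1, 1)].
Proof.
pose D v m0 := all (fun m => (displacement m == v) ==> (m == m0)) moves.
have DP v m0 m' : D v m0 -> m' \in moves -> displacement m' = v -> m' = m0.
  by move=> /allP h /h /implyP h' /eqP /h' /eqP.
by move=> mM; split; apply: DP mM.
Qed.

Lemma arrow_NE p : arrow p (p + (1, 1)) ->
  exists u w s r, state A (M p).1 (M p).2 u w s r /\ (2 * A < u /\ w < - 2).
Proof.
move=> /arrow_state[u [w [s [r [sg [dl [gm [bt [/addrI/esym qE S Mv _]]]]]]]]].
have [/(_ qE) [? ? ? ?] _ _ _] := displacement_diagonal (move_cases hA S.1 Mv).
subst sg dl gm bt; exists u, w, s, r; split=> //.
exact: move_NE Mv.
Qed.

Lemma arrow_SW p : arrow p (p + (-1, -1)) ->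
  exists u w s r, state A (M p).1 (M p).2 u w s r /\ (u < 4 - 2 * A /\ - 2 * A < w).
Proof.
move=> /arrow_state[u [w [s [r [sg [dl [gm [bt [/addrI/esym qE S Mv _]]]]]]]]].
have [_ /(_ qE) [? ? ? ?] _ _] := displacement_diagonal (move_cases hA S.1 Mv).
subst sg dl gm bt; exists u, w, s, r; split=> //.
exact: move_SW Mv.
Qed.

Lemma arrow_SE p : arrow p (p + (1, -1)) ->
  exists u w s r, state A (M p).1 (M p).2 u w s r /\ (u < 2 * A /\ w < - 2 * A).
Proof.
move=> /arrow_state[u [w [s [r [sg [dl [gm [bt [/addrI/esym qE S Mv _]]]]]]]]].
have [_ _ /(_ qE) [? ? ? ?] _] := displacement_diagonal (move_cases hA S.1 Mv).
subst sg dl gm bt; exists u, w, s, r; split=> //.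
exact: move_SE Mv.
Qed.

Lemma arrow_NW p : arrow p (p + (-1, 1)) ->
  exists u w s r, state A (M p).1 (M p).2 u w s r /\ (4 - 2 * A < u /\ - 2 < w).
Proof.
move=> /arrow_state[u [w [s [r [sg [dl [gm [bt [/addrI/esym qE S Mv _]]]]]]]]].
have [_ _ _ /(_ qE) [? ? ? ?]] := displacement_diagonal (move_cases hA S.1 Mv).
subst sg dl gm bt; exists u, w, s, r; split=> //.
exact: move_NW Mv.
Qed.

(** The abscissa grows by [2 * A * i + 2 * j] and the height by [2 * (i + j)] modulo 4, so [j]
    cancels in [u] and [i] cancels in [w]. *)
Lemma state_translate p (i j : int) u w s r u' w' s' r' :
  state A (M p).1 (M p).2 u w s r ->
  state A (M (p + (i, j))).1 (M (p + (i, j))).2 u' w' s' r' ->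
  exists a b : int, u' = u + 2 * (1 - A) * i%:~R + 4 * a%:~R /\
    w' = w - 4 * A * a%:~R + 2 * (1 - A) * j%:~R - 2 * (1 + A) * b%:~R.
Proof.
move=> S S'; have [a [b [_ [_ [ua wb _ _]]]]] := state_shift S S'.
move: ua wb; case: p {S S'} => m n /=.
have [_ [k kE]] := level_sign (m + n).
have [_ [k' k'E]] := level_sign (m + i + (n + j)).
rewrite kE k'E => -> ->.
exists (a + k' - k), b; rewrite !(rmorphD, rmorphB, rmorphM, rmorphN) /=.
by split; ring.
Qed.

(** The tails of two crossing arrows are neighbours. If they are vertical neighbours, they share
    [u]; if horizontal, the ranges of [u] force [a = 0] and they share [w]. The bounds for the two
    diagonals then exclude each other. *)
Lemma arrow_no_crossing p :
  arrow p (p + (1, 1)) \/ arrow (p + (1, 1)) p ->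
  arrow (p + (1, 0)) (p + (0, 1)) \/ arrow (p + (0, 1)) (p + (1, 0)) -> False.
Proof.
have /andP[A0 A1] := hA.
have LA : 0 < 2 * (1 + A) by lra.
have shiftE (q v v' : int * int) : v + v' = 0 -> q + v + v' = q.
  by move=> e; rewrite -addrA e addr0.
have nw : p + (0, 1) = p + (1, 0) + (-1, 1) by rewrite -addrA.
have se : p + (1, 0) = p + (0, 1) + (1, -1) by rewrite -addrA.
have swE : p = p + (1, 1) + (-1, -1) by rewrite shiftE.
have e1 : p + (1, 0) = p + (1, 1) + (0, -1) by rewrite -addrA.
have e2 : p + (0, 1) = p + (1, 1) + (-1, 0) by rewrite -addrA.
move=> [/arrow_NE ar|ar] [ar'|ar'].
- move: ar => [u [w [s [r [S [u0 w0]]]]]].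
  move: ar'; rewrite nw => /arrow_NW[u' [w' [s' [r' [S' [u0' w0']]]]]].
  have [a [b [ua wb]]] := state_translate S S'.
  have [[/andP[u1 u2] /andP[w1 w2] _ _] _] := S.
  have [[/andP[u3 u4] /andP[w3 w4] _ _] _] := S'.
  have [e|e|e] : [\/ a = -1, a = 0 | a = 1].
  + by apply: (@small_int _ _ 4) => //; move: ua u1 u2 u3 u4 A0 A1; clear; lra.
  + by subst a; move: ua u1 u2 u0'; rewrite rmorphN /=; clear; lra.
  + subst a; have [e|e|e] : [\/ b = -1, b = 0 | b = 1].
    * by apply: (small_int LA); move: wb w1 w2 w3 w4 A0 A1; clear; lra.
    * by subst b; move: wb w1 w2 w3 w4 w0 w0' A0 A1; rewrite rmorphN /=; clear; lra.
    * by subst b; move: wb w0 w0'; clear; lra.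
    * by subst b; move: wb w0 w0' w3 A0; clear; lra.
  + by subst a; move: ua u0 u1 u4 A1; clear; lra.
- move: ar => [u [w [s [r [S [u0 w0]]]]]].
  move: ar'; rewrite se => /arrow_SE[u' [w' [s' [r' [S' [u0' w0']]]]]].
  have [a [b [ua _]]] := state_translate S S'.
  have [[/andP[u1 u2] _ _ _] _] := S; have [[/andP[u3 u4] _ _ _] _] := S'.
  have [e|e|e] : [\/ a = -1, a = 0 | a = 1].
  + by apply: (@small_int _ _ 4) => //; move: ua u1 u2 u3 u4; clear; lra.
  + by subst a; move: ua u2 u3; rewrite rmorphN /=; clear; lra.
  + by subst a; move: ua u0 u0'; clear; lra.
  + by subst a; move: ua u1 u4; clear; lra.
- move: ar; rewrite {2}swE => /arrow_SW[u [w [s [r [S [u0 w0]]]]]].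
  move: ar'; rewrite nw e1 => /arrow_NW[u' [w' [s' [r' [S' [u0' w0']]]]]].
  have [a [b [ua _]]] := state_translate S S'.
  have [[/andP[u1 u2] _ _ _] _] := S; have [[/andP[u3 u4] _ _ _] _] := S'.
  have [e|e|e] : [\/ a = -1, a = 0 | a = 1].
  + by apply: (@small_int _ _ 4) => //; move: ua u1 u2 u3 u4; clear; lra.
  + by subst a; move: ua u2 u3; rewrite rmorphN /=; clear; lra.
  + by subst a; move: ua u0 u0'; clear; lra.
  + by subst a; move: ua u1 u4; clear; lra.
move: ar; rewrite {2}swE => /arrow_SW[u [w [s [r [S [u0 w0]]]]]].
move: ar'; rewrite se e2 => /arrow_SE[u' [w' [s' [r' [S' [u0' w0']]]]]].
have [a [b [ua wb]]] := state_translate S S'.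
have [[/andP[u1 u2] /andP[w1 w2] _ _] _] := S.
have [[/andP[u3 u4] /andP[w3 w4] _ _] _] := S'.
rewrite rmorphN /= in ua.
have [e|e|e] : [\/ a = -1, a = 0 | a = 1].
- by apply: (@small_int _ _ 4) => //; move: ua u1 u2 u3 u4 A0 A1; clear; lra.
- by subst a; move: ua u0 u2 u3 A1; rewrite rmorphN /=; clear; lra.
- subst a; have [e|e|e] : [\/ b = -1, b = 0 | b = 1].
  + by apply: (small_int LA); move: wb w1 w2 w3 w4 A0 A1; clear; lra.
  + by subst b; move: wb w1 w2 w3 w4 w0 w0' A0 A1; rewrite rmorphN /=; clear; lra.
  + by subst b; move: wb w0 w0'; clear; lra.
  + by subst b; move: wb w2 w3; clear; lra.
- by subst a; move: ua u1 u0' u4 A0 A1; clear; lra.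
Qed.

End Lattice.

(** * Curves traced by king's moves *)

Section Curves.
Local Open Scope classical_set_scope.
Variables (R : realType) (E : int * int -> int * int -> Prop).
Implicit Types (p q : int * int) (v : int -> int * int) (i j k : int).

Hypothesis E_fun : forall p q q', E p q -> E p q' -> q = q'.
Hypothesis E_inj : forall p p' q, E p q -> E p' q -> p = p'.
Hypothesis E_next : forall p q, E p q -> exists r, E q r.
Hypothesis E_prev : forall p q, E p q -> exists r, E r p.
Hypothesis E_close : forall p q, E p q -> `|p.1 - q.1| <= 1 /\ `|p.2 - q.2| <= 1.
Hypothesis E_no_backtrack : forall p q, E p q -> E q p -> p = q.
Hypothesis E_no_crossing : forall p, E p (p + (1, 1)) \/ E (p + (1, 1)) p ->
  E (p + (1, 0)) (p + (0, 1)) \/ E (p + (0, 1)) (p + (1, 0)) -> False.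

Definition chain v : Prop := forall k, E (v k) (v (k + 1)) /\ v k <> v (k + 1).

Lemma chain_shift v v' i j k : chain v -> chain v' -> v i = v' j ->
  v (i + k) = v' (j + k).
Proof.
move=> cv cv' e; elim/int_ind: k => [|n IH|n IH]; first by rewrite !addr0.
  have [En _] := cv (i + n); have [En' _] := cv' (j + n).
  by rewrite -addn1 PoszD !addrA; apply: E_fun En _; rewrite IH.
have [En _] := cv (i - n.+1%:Z); have [En' _] := cv' (j - n.+1%:Z).
have sh (z : int) : z - n.+1%:Z + 1 = z - n%:Z by rewrite -addn1 PoszD opprD addrA subrK.
by apply: E_inj En _; rewrite sh IH -sh.
Qed.

(** One coordinate of two meeting edges whose starting points are [c] apart. Each term is less than
    1 in absolute value, so a gap of 1 requires both edges to advance towards each other. *)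
Lemma coordinate_meet (a b : R) (c d d' : int) : 0 < a < 1 -> 0 < b < 1 ->
  `|d| <= 1 -> `|d'| <= 1 -> c%:~R = a * d%:~R - b * d'%:~R ->
  c = 0 /\ d = d' \/ (c = 1 \/ c = -1) /\ d = c /\ d' = - c.
Proof.
move=> /andP[a0 a1] /andP[b0 b1] hd hd'.
have : d = -1 \/ d = 0 \/ d = 1 by lia.
have : d' = -1 \/ d' = 0 \/ d' = 1 by lia.
have rng : c <= -2 \/ c = -1 \/ c = 0 \/ c = 1 \/ 2 <= c by lia.
have rng' : c%:~R <= -2 :> R \/ c = -1 \/ c = 0 \/ c = 1 \/ 2 <= c%:~R :> R.
  case: rng => [h|[|[|[|h]]]]; [left|tauto|tauto|tauto|do 4!right].
    have : c%:~R <= (-2)%:~R :> R by rewrite ler_int.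
    by rewrite rmorphN.
  by have : 2%:~R <= c%:~R :> R by rewrite ler_int.
move=> [|[|]] -> [|[|]] ->; rewrite ?rmorphN /=;
case: rng' => [h|[->|[->|[->|h]]]]; rewrite ?rmorphN /= => e;
try (by exfalso; lra); by [left|right; split; [left|split]|right; split; [right|split]].
Qed.

Lemma coordinate_meet0 (b : R) (c d : int) : 0 <= b < 1 -> `|d| <= 1 ->
  c%:~R = b * d%:~R -> c = 0.
Proof.
move=> /andP[b0 b1] hd.
have dE : d = -1 \/ d = 0 \/ d = 1 by lia.
move=> e; have z1 : (- 1)%:~R < c%:~R :> R.
  by rewrite e mulrN1z; case: dE => [|[|]] ->; rewrite ?mulrN1z; lra.
have z2 : c%:~R < 1%:~R :> R.
  by rewrite e mulr1z; case: dE => [|[|]] ->; rewrite ?mulrN1z; lra.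
by rewrite !ltr_int in z1 z2; lia.
Qed.

Lemma no_crossing m n p q p' q' : E p q -> E p' q' ->
  p = (m, n) /\ q = (m + 1, n + 1) \/ p = (m + 1, n + 1) /\ q = (m, n) ->
  p' = (m + 1, n) /\ q' = (m, n + 1) \/ p' = (m, n + 1) /\ q' = (m + 1, n) ->
  False.
Proof.
move=> pq pq' dE dE'; apply: (@E_no_crossing (m, n)).
  rewrite -[(m, n) + (1, 1)]/(m + 1, n + 1).
  by case: dE => -[<- <-]; [left|right].
have -> : (m, n) + (1, 0) = (m + 1, n) by congr pair; rewrite addr0.
have -> : (m, n) + (0, 1) = (m, n + 1) by congr pair; rewrite addr0.
by case: dE' => -[<- <-]; [left|right].
Qed.

(** Parameters are half-open, so a vertex counts only for the edge that leaves it. *)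
Lemma edges_meet p q p' q' (a b : R) : 0 <= a < 1 -> 0 <= b < 1 ->
  E p q -> p <> q -> E p' q' -> p' <> q' ->
  lerp (lattice_point R p) (lattice_point R q) a =
  lerp (lattice_point R p') (lattice_point R q') b ->
  p = p' /\ a = b.
Proof.
move=> a01 b01 Epq npq Epq' npq'.
have [c1 c2] := E_close Epq; have [c3 c4] := E_close Epq'.
rewrite /lerp /lattice_point /=.
have [pp|pp] := eqVneq p p'.
  subst p'; have qq := E_fun Epq Epq'; subst q'.
  move=> [e1 e2]; split=> //; apply/eqP; rewrite -subr_eq0.
  have h1 : (a - b) * (q.1 - p.1)%:~R = 0 by rewrite rmorphB /=; lra.
  have h2 : (a - b) * (q.2 - p.2)%:~R = 0 by rewrite rmorphB /=; lra.
  apply/negPn/negP => ab; apply: npq.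
  move/eqP: h1; rewrite mulf_eq0 (negPf ab) intr_eq0 subr_eq0 => /eqP h1.
  move/eqP: h2; rewrite mulf_eq0 (negPf ab) intr_eq0 subr_eq0 => /eqP h2.
  by rewrite [p]surjective_pairing [q]surjective_pairing h1 h2.
move=> [e1 e2]; exfalso.
have f1 : (p'.1 - p.1)%:~R = a * (q.1 - p.1)%:~R - b * (q'.1 - p'.1)%:~R.
  by rewrite !rmorphB /=; lra.
have f2 : (p'.2 - p.2)%:~R = a * (q.2 - p.2)%:~R - b * (q'.2 - p'.2)%:~R.
  by rewrite !rmorphB /=; lra.
have xy0 : p'.1 - p.1 = 0 -> p'.2 - p.2 = 0 -> False.
  move=> /eqP + /eqP; rewrite !subr_eq0 => /eqP x0 /eqP y0.
  by move/eqP: pp; apply; rewrite [p]surjective_pairing [p']surjective_pairing x0 y0.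
have b1 : `|q.1 - p.1| <= 1 by lia.
have b2 : `|q.2 - p.2| <= 1 by lia.
have b3 : `|q'.1 - p'.1| <= 1 by lia.
have b4 : `|q'.2 - p'.2| <= 1 by lia.
have a0 : 0 < a < 1.
  have /andP[a0 ->] := a01; rewrite andbT lt_neqAle a0 andbT.
  apply/eqP => a_0; rewrite -a_0 !mul0r !sub0r in f1 f2.
  apply: xy0; apply/eqP; rewrite -oppr_eq0; apply/eqP;
  [apply: (coordinate_meet0 b01 b3)|apply: (coordinate_meet0 b01 b4)];
  by rewrite rmorphN /= ?f1 ?f2 opprK.
have b0 : 0 < b < 1.
  have /andP[b0 ->] := b01; rewrite andbT lt_neqAle b0 andbT.
  apply/eqP => b_0; rewrite -b_0 !mul0r !subr0 in f1 f2.
  by apply: xy0; [exact: coordinate_meet0 a01 b1 f1|exact: coordinate_meet0 a01 b2 f2].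
have H1 := coordinate_meet a0 b0 b1 b3 f1.
have H2 := coordinate_meet a0 b0 b2 b4 f2.
move: p q p' q' Epq npq Epq' npq' b1 b2 xy0 H1 H2 {c1 c2 c3 c4 pp f1 f2 e1 e2 b3 b4}
  => [p1 p2] [q1 q2] [p1' p2'] [q1' q2'] /= Epq npq Epq' npq' b1 b2 xy0 H1 H2.
have back : (p1', p2') = (q1, q2) -> (q1', q2') = (p1, p2) -> False.
  move=> e e'; rewrite e e' in Epq'; apply: npq; exact: E_no_backtrack Epq Epq'.
(* Coordinates opposite in both directions, or opposite in one and constant in the other, mean the
   same edge reversed. Opposite in one and equally moving in the other means the two diagonals of a
   unit square. *)
case: H1 => [[x0 d1]|[x1 [d1 d1']]]; case: H2 => [[y0 d2]|[y1 [d2 d2']]].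
- exact: xy0 x0 y0.
- have [d10|[d10|d10]] : q1 = p1 \/ q1 = p1 + 1 \/ p1 = q1 + 1 by lia.
  + by apply: back; congr pair; lia.
  + case: y1 => y1.
      by apply: (no_crossing (m := p1) (n := p2) Epq Epq');
        [left|right]; split; congr pair; lia.
    by apply: (no_crossing (m := p1) (n := q2) Epq' Epq);
      [left|right]; split; congr pair; lia.
  + case: y1 => y1.
      by apply: (no_crossing (m := q1) (n := p2) Epq' Epq);
        [right|left]; split; congr pair; lia.
    by apply: (no_crossing (m := q1) (n := q2) Epq Epq');
      [right|left]; split; congr pair; lia.
- have [d20|[d20|d20]] : q2 = p2 \/ q2 = p2 + 1 \/ p2 = q2 + 1 by lia.
  + by apply: back; congr pair; lia.
  + case: x1 => x1.
      by apply: (no_crossing (m := p1) (n := p2) Epq Epq'); left;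
        split; congr pair; lia.
    by apply: (no_crossing (m := q1) (n := p2) Epq' Epq); left;
      split; congr pair; lia.
  + case: x1 => x1.
      by apply: (no_crossing (m := p1) (n := q2) Epq' Epq); right;
        split; congr pair; lia.
    by apply: (no_crossing (m := q1) (n := q2) Epq Epq'); right;
      split; congr pair; lia.
by apply: back; congr pair; lia.
Qed.

(** * Chains as embedded curves *)

Lemma chains_meet v v' (s t : R) : chain v -> chain v' ->
  polyline v s = polyline v' t ->
  v (Num.floor s) = v' (Num.floor t) /\
  s - t = (Num.floor s - Num.floor t)%:~R.
Proof.
move=> cv cv'; rewrite /polyline => e.
have [E1 n1] := cv (Num.floor s); have [E2 n2] := cv' (Num.floor t).
have frac (z : R) : 0 <= z - (Num.floor z)%:~R < 1.
  by have /andP[h1 h2] := floor_itv z; rewrite rmorphD /= in h2; apply/andP; split; lra.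
have [-> ab] := edges_meet (frac s) (frac t) E1 n1 E2 n2 e.
by split=> //; rewrite rmorphB /=; lra.
Qed.

Lemma chain_embedded v : chain v ->
  embedded_polygon R v \/ embedded_biinfinite_curve R v.
Proof.
move=> cv.
have [inj|] := pselect (injective v).
  right=> s t e; have [vE st] := chains_meet cv cv e.
  by apply/eqP; rewrite -subr_eq0 st (inj _ _ vE) subrr.
move=> ninj; left.
have [n0 n0P] : exists n : nat, (0 < n)%N && (v n == v 0).
  have [i [j [vij ij]]] : exists i j, v i = v j /\ i < j.
    apply: contrapT => h; apply: ninj => i j vij.
    have [ij|ij|//] := ltgtP i j; case: h; first by exists i, j.
    by exists j, i.
  exists `|j - i|%N; apply/andP; split; first by lia.
  have := chain_shift (- i) cv cv vij; rewrite subrr => ->.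
  by apply/eqP; congr v; lia.
have exk : exists n : nat, (0 < n)%N && (v n == v 0) by exists n0.
have [k /andP[k0 /eqP vk] kmin] := ex_minnP exk.
have per i : v (i + k%:Z) = v i.
  by have := chain_shift i cv cv vk; rewrite addrC => ->; rewrite add0r.
have perM (m : nat) i : v (i + m%:Z * k%:Z) = v i.
  elim: m i => [|m IH] i; first by rewrite mul0r addr0.
  by rewrite -addn1 PoszD mulrDl mul1r addrA per IH.
have perZ (m i : int) : v (i + m * k%:Z) = v i.
  case: m => m; first exact: perM.
  by rewrite -(perM m.+1 (i + Negz m * k%:Z)) NegzE mulNr subrK.
(* Period 1 would give a trivial edge, and period 2 would be backtracking. *)
exists k.
  case: k k0 vk {kmin per perM perZ} => [|[|[|k]]] // _ vk.
    by have [_] := cv 0; rewrite add0r vk.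
  have [E01 n01] := cv 0; have [E12 _] := cv 1.
  by case: n01; apply: E_no_backtrack E01 _; rewrite -[in v 0]vk.
split=> // s t e; have [vE ->] := chains_meet cv cv e.
set i := Num.floor s in vE *; set j := Num.floor t in vE *.
exists ((i - j) %/ k%:Z)%Z; congr (_%:~R).
have kk : k%:Z != 0 by rewrite -lt0n in k0 *; lia.
rewrite {1}(divz_eq (i - j) k%:Z).
have r0 := modz_ge0 (i - j) kk.
have rk : ((i - j) %% k%:Z)%Z < k%:Z by apply: ltz_pmod.
(* A nonzero remainder would be a smaller return time than [k]. *)
suff -> : ((i - j) %% k%:Z)%Z = 0 by rewrite addr0.
have vr : v ((i - j) %% k%:Z)%Z = v 0.
  have := chain_shift (- j) cv cv vE; rewrite subrr => <-.
  by rewrite -[LHS](perZ ((i - j) %/ k%:Z)%Z) [(_ %% _)%Z + _]addrC -divz_eq.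
move: r0 rk vr; case: ((i - j) %% k%:Z)%Z => // r _ rk vr.
apply/eqP; rewrite eqz_nat; case: r rk vr => // r rk vr.
have := kmin r.+1; rewrite vr eqxx /= => /(_ isT) h.
by move: rk; rewrite ltz_nat ltnNge h.
Qed.

Definition successor p := xget p [set q | E p q].
Definition predecessor p := xget p [set q | E q p].

Definition orbit_curve p (k : int) : int * int :=
  match k with
  | Posz n => iter n successor p
  | Negz n => iter n.+1 predecessor p
  end.

(** Excludes the isolated vertices. By injectivity, an orbit that moves once never reaches a fixed
    vertex. *)
Definition moving p := exists2 q, E p q & p <> q.

Lemma moving_successor p : moving p ->
  [/\ E p (successor p), p <> successor p & moving (successor p)].
Proof.
move=> [q pq npq].
have <- : q = successor p.
  by rewrite /successor; case: xgetP => [r _ /(E_fun pq)//|/(_ q)].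
split=> //; have [r qr] := E_next pq; exists r => // e.
by apply: npq; rewrite -e in qr; apply: E_inj pq qr.
Qed.

Lemma moving_predecessor p : moving p ->
  [/\ E (predecessor p) p, predecessor p <> p & moving (predecessor p)].
Proof.
move=> [q pq npq]; have [r rp] := E_prev pq.
have <- : r = predecessor p.
  by rewrite /predecessor; case: xgetP => [r' _ /(E_inj rp)//|/(_ r)].
have nrp : r <> p by move=> e; rewrite e in rp; apply: npq; apply: E_fun rp pq.
by split=> //; exists p.
Qed.

Lemma orbit_curve_chain p : moving p -> chain (orbit_curve p).
Proof.
move=> mp.
have mS n : moving (iter n successor p).
  by elim: n => //= n /moving_successor[].
have mP n : moving (iter n predecessor p).
  by elim: n => //= n /moving_predecessor[].
case=> n.
  by rewrite -PoszD addn1 /=; have [] := moving_successor (mS n).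
have -> : orbit_curve p (Negz n + 1) = iter n predecessor p.
  have -> : Negz n + 1 = - n%:Z by rewrite NegzE -addn1 PoszD opprD subrK.
  by case: n.
by have [] := moving_predecessor (mP n).
Qed.

Definition orbit_of p := [set q | exists k, orbit_curve p k = q].

Lemma orbit_of_eq p q : moving p -> moving q -> orbit_of p q ->
  orbit_of p = orbit_of q.
Proof.
move=> mp mq [k kE].
have cp := orbit_curve_chain mp; have cq := orbit_curve_chain mq.
have e : orbit_curve p k = orbit_curve q 0 by [].
apply/seteqP; split=> r [n <-].
  exists (n - k); have := chain_shift (n - k) cp cq e.
  by rewrite add0r addrC subrK => ->.
exists (k + n); rewrite (chain_shift n cp cq e) add0r //.
Qed.

(* Constant on each orbit: it depends on p only through the set orbit_of p. *)
Definition representative p := xget (0, 0) (orbit_of p).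

Lemma representative_in p : orbit_of p (representative p).
Proof.
by rewrite /representative; case: xgetP => [//|/(_ p)] []; exists 0.
Qed.

Lemma moving_orbit p q : moving p -> orbit_of p q -> moving q.
Proof.
move=> /orbit_curve_chain cp [k <-].
by exists (orbit_curve p (k + 1)); case: (cp k).
Qed.

Lemma embedded_curves :
  disjoint_union_of_embedded_curves R (fun p q => p <> q /\ (E p q \/ E q p)).
Proof.
have mrep p : moving p -> moving (representative p).
  by move=> mp; apply: moving_orbit (representative_in p).
have erep p : moving p -> orbit_of p = orbit_of (representative p).
  by move=> mp; apply: orbit_of_eq (representative_in p) => //; apply: mrep.
(* Different starting points on one orbit would give different sequences with the same range,
   violating [trivIset]; the representative selects one per orbit. *)
exists [set v | exists2 p, moving p & v = orbit_curve (representative p)]; split.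
- move=> v [p mp ->]; apply: chain_embedded => //.
  by apply: orbit_curve_chain; apply: mrep.
- move=> v v' [p mp ->] [p' mp' ->] [z [[s _ <-] [t _ e]]].
  have cp := orbit_curve_chain (mrep _ mp); have cp' := orbit_curve_chain (mrep _ mp').
  have [vE _] := chains_meet cp cp' (esym e).
  suff -> : representative p = representative p' by [].
  rewrite /representative (erep _ mp) (erep _ mp').
  have o1 : orbit_of (representative p)
    (orbit_curve (representative p) (Num.floor s)) by eexists.
  have o2 : orbit_of (representative p')
    (orbit_curve (representative p) (Num.floor s)).
    by rewrite vE; eexists.
  have mo := moving_orbit (mrep _ mp) o1.
  by rewrite (orbit_of_eq (mrep _ mp) mo o1) (orbit_of_eq (mrep _ mp') mo o2).
move=> p q.
have on_curve p1 q1 : E p1 q1 -> p1 <> q1 -> exists2 v,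
    (exists2 p, moving p & v = orbit_curve (representative p)) &
    exists k, p1 = v k /\ q1 = v (k + 1).
  move=> E1 n1; have mp : moving p1 by exists q1.
  exists (orbit_curve (representative p1)); first by exists p1.
  have [k kE] : orbit_of (representative p1) p1 by rewrite -erep //; exists 0.
  exists k; split=> //; have [Ek _] := orbit_curve_chain (mrep _ mp) k.
  by rewrite kE in Ek; apply: E_fun Ek.
split.
  move=> [npq [Epq|Eqp]].
    by have [v Cv [k ?]] := on_curve _ _ Epq npq; exists v => //; exists k; left.
  by have [v Cv [k ?]] := on_curve _ _ Eqp (nesym npq); exists v => //; exists k; right.
move=> [_ [p1 mp1 ->] [k]].
have [Ek nk] := orbit_curve_chain (mrep _ mp1) k.
by move=> [[-> ->]|[-> ->]]; split; [|left|exact: nesym|right].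
Qed.

End Curves.

Theorem theorem2p6 (R : realType) (A alpha : R)
    (hA : 0 < A < 1) (halpha : 0 < alpha)
    (hwd : arith_graph_well_defined A alpha) :
  disjoint_union_of_embedded_curves R (arith_graph_edge A alpha).
Proof.
apply: embedded_curves.
- exact: arrow_fun.
- exact: arrow_inj.
- move=> p q [_ Xq _ _].
  have [u [w [s [r [sg [dl [gm [bt [_ _ ar _]]]]]]]]] := arrow_exists hA hwd Xq.
  by eexists; apply: ar.
- by move=> p q [Xp _ _ _]; apply: arrow_exists_before.
- by move=> p q; apply: arrow_close.
- exact: arrow_no_backtrack.
- exact: arrow_no_crossing.
Qed.
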